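(* Let $w=(w_1,\ldots,w_m)\in(0,1)^m$ be weights such that $w_1+\cdots+w_m=1$, and let $(A_1,\ldots,A_m)\in(\mathrm{UT}_n)^m$. Then there exists a unique $w$-weighted Karcher mean $X\in\mathrm{UT}_n$, i.e. a unique $X\in \mathrm{UT}_n$ satisfying the Karcher equation $$\sum_{i=1}^m w_i\log(X^{-1}A_i)=0.$$ Moreover, $X$ depends analytically on the entries of $A_1,\ldots,A_m$.
   Context: $\mathrm{UT}_n$ is the Lie group of $n\times n$ real upper triangular matrices with positive diagonal entries, and $\mathfrak{ut}_n$ is its Lie algebra of all $n\times n$ real upper triangular matrices. The matrix exponential $\exp:\mathfrak{ut}_n\to\mathrm{UT}_n$ is an analytic diffeomorphism, and $\log:\mathrm{UT}_n\to\mathfrak{ut}_n$ denotes its inverse. ''Analytically'' means real-analytically, on the (open) set of matrix tuples $(\mathrm{UT}_n)^m$. *)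

(* Defs.v *)
From mathcomp Require Import all_boot all_order all_algebra.
From mathcomp Require Import all_classical all_reals all_analysis.
From mathcomp.analysis.showcase Require summability.
Set Implicit Arguments.
Unset Strict Implicit.
Unset Printing Implicit Defensive.
Import Order.TTheory GRing.Theory Num.Theory.
Import numFieldNormedType.Exports.
Local Open Scope classical_set_scope.
Local Open Scope ring_scope.

(* [is_trig_mx] means lower triangular, hence the transposes. *)
Definition ut (R : realType) (n : nat) : set 'M[R]_n :=
  [set A | is_trig_mx A^T].

Definition UT (R : realType) (n : nat) : set 'M[R]_n :=
  [set A | is_trig_mx A^T /\ forall i, 0 < A i i].

Definition expmx (R : realType) (n : nat) (A : 'M[R]_n) : 'M[R]_n :=
  limn (series (fun k => k`!%:R^-1 *: A ^+ k)).

(* The inverse of [expmx] restricted to [ut]; the default value 0 is taken only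
   outside the image of [ut]. *)
Definition logmx (R : realType) (n : nat) : 'M[R]_n -> 'M[R]_n :=
  'pinv_(fun=> 0) (@ut R n) (@expmx R n).

Definition is_karcher_mean (R : realType) (n m : nat) (w : 'I_m -> R)
    (A : 'I_m -> 'M[R]_n) (X : 'M[R]_n) : Prop :=
  UT X /\ \sum_i w i *: logmx (invmx X *m A i) = 0.

(* [a] is expanded in the coordinates indexed by [J]; [alpha] ranges over
   multi-indices.  Convergence along finite sets of multi-indices is
   unconditional, i.e. absolute, convergence of the power series. *)
Definition analytic_at (R : realType) (J : finType) (f : (J -> R) -> R)
    (a : J -> R) : Prop :=
  exists (c : {ffun J -> nat} -> R) (r : R), 0 < r /\
    forall x : J -> R, (forall j, `|x j - a j| < r) ->
      summability.partial_sum
        (fun alpha : {ffun J -> nat} =>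
           c alpha * \prod_j (x j - a j) ^+ alpha j)
        @ summability.totally --> f x.

(* Meant for open [U]: the values of [f] near each point of [U] matter. *)
Definition analytic_on (R : realType) (J : finType) (U : set (J -> R))
    (f : (J -> R) -> R) : Prop :=
  forall a, U a -> analytic_at f a.

(* The positions of the entries on or above the diagonal: these index the
   coordinates of [ut], in which [UT] is an open set. *)
Definition upper (n : nat) : finType :=
  {p : 'I_n * 'I_n | (p.1 <= p.2)%N}.

Definition utmx (R : realType) (n : nat) (v : upper n -> R) : 'M[R]_n :=
  \matrix_(i, j) oapp v 0 (insub (i, j)).

Definition ut_tuple (R : realType) (n m : nat) (x : 'I_m * upper n -> R)
    (k : 'I_m) : 'M[R]_n :=
  utmx (fun p => x (k, p)).

(* [F], a function of [m]-tuples of matrices, depends analytically on the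
   entries of its argument, on the tuples of elements of [UT]. *)
Definition analytic_on_UT (R : realType) (n m : nat)
    (F : ('I_m -> 'M[R]_n) -> 'M[R]_n) : Prop :=
  forall i j, analytic_on [set x | forall k, UT (ut_tuple x k)]
                          (fun x => F (ut_tuple x) i j).

(* Main.v *)
(* Writing [X^-1 A_k = exp Y_k], the Karcher equation becomes the system
   [X exp(Y_k) = A_k], [sum_k w_k Y_k = 0], with [X] and the [Y_k] upper
   triangular.  Its diagonal part is solved by [X_ii = prod_k (A_k)_ii ^ w_k].
   Once all entries strictly below the d-th superdiagonal are known, the entries
   at a position [(i, j)] with [j = i + d] satisfy
     [(X_ij - known) e_k + p_k (Y_k)_ij = b_k] for all [k],
     [sum_k w_k (Y_k)_ij = 0],
   where [e_k = exp((Y_k)_jj) > 0] and [p_k] is [X_ii] times the divided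
   difference of [exp] at [(Y_k)_ii] and [(Y_k)_jj], hence positive.  This linear
   system has exactly one solution, which gives existence and uniqueness one
   superdiagonal after the other.  The solution is a rational expression in
   logarithms, exponentials and entries of matrix exponentials, so analyticity
   propagates along the same induction. *)
Require Import Defs.
From mathcomp Require Import all_boot all_order all_algebra.
From mathcomp Require Import all_classical all_reals all_analysis.
From mathcomp Require Import finmap ring lra zify.
From mathcomp.analysis.showcase Require Import summability.
Set Implicit Arguments.
Unset Strict Implicit.
Unset Printing Implicit Defensive.
Import Order.TTheory GRing.Theory Num.Theory.
Import numFieldNormedType.Exports.
Local Open Scope classical_set_scope.
Local Open Scope ring_scope.

(** * Unconditionally convergent sums *)

#[local] Existing Instance summability.totally_filter.

(** The mode of convergence in [analytic_at], for an arbitrary index type. *)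
Definition has_sum (R : realType) (I : choiceType) (f : I -> R) (l : R) : Prop :=
  summability.partial_sum f @ summability.totally --> l.

(** Absolute summability with an explicit bound, which may exceed the sum: the norms of power series
    are estimated by tracking [C]. *)
Definition abs_bounded (R : realType) (I : choiceType) (f : I -> R) (C : R)
    : Prop :=
  forall A : {fset I}, \sum_(i <- A) `|f i| <= C.

Section has_sum_theory.
Variable R : realType.
Implicit Types I K : choiceType.

Lemma ler_sum_sub (T : eqType) (s t : seq T) (F : T -> R) :
  (forall x, 0 <= F x) -> uniq s -> uniq t -> {subset s <= t} ->
  \sum_(x <- s) F x <= \sum_(x <- t) F x.
Proof.
move=> F0 us ut st; rewrite (perm_big [seq x <- t | x \in s]); last first.
  apply: uniq_perm; rewrite ?filter_uniq // => x.
  by rewrite mem_filter; case: (boolP (x \in s)) => // /st ->.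
rewrite big_filter [leRHS](bigID (mem s)) /= lerDl.
exact: sumr_ge0.
Qed.

Lemma partial_sumE I (f : I -> R) (A : {fset I}) :
  summability.partial_sum f A = \sum_(i <- A) f i.
Proof. by rewrite /summability.partial_sum big_seq_fsetE. Qed.

Lemma near_totally I (A : {fset I}) (P : set {fset I}) :
  (forall B : {fset I}, (A `<=` B)%fset -> P B) -> \forall B \near totally, P B.
Proof. by move=> h; exists A. Qed.

Lemma has_sumP I (f : I -> R) (l : R) :
  has_sum f l <-> forall e : R, 0 < e -> exists A : {fset I},
    forall B : {fset I}, (A `<=` B)%fset -> `|l - \sum_(i <- B) f i| < e.
Proof.
split=> [/cvgrPdist_lt h e /h [A _ hA]|h].
  by exists A => B /hA; rewrite /= partial_sumE.
apply/cvgrPdist_lt => e /h [A hA]; apply: (@near_totally _ A) => B /hA.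
by rewrite partial_sumE.
Qed.

Lemma has_sum_unique I (f : I -> R) (l l' : R) :
  has_sum f l -> has_sum f l' -> l = l'.
Proof. exact: cvg_unique. Qed.

Lemma eq_has_sum I (f g : I -> R) (l : R) :
  f =1 g -> has_sum f l -> has_sum g l.
Proof. by move=> /funext ->. Qed.

Lemma has_sumD I (f g : I -> R) (l l' : R) :
  has_sum f l -> has_sum g l' -> has_sum (fun i => f i + g i) (l + l').
Proof.
move=> hf hg; have := cvgD hf hg; rewrite /has_sum.
have -> : partial_sum (fun i => f i + g i) = partial_sum f + partial_sum g.
  by apply/funext => A /=; rewrite /partial_sum big_split.
exact.
Qed.

Lemma has_sumZ I (f : I -> R) (l k : R) :
  has_sum f l -> has_sum (fun i => k * f i) (k * l).
Proof.
move=> hf; have := cvgMl_tmp (a := k) hf; rewrite /has_sum.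
have -> : partial_sum (fun i => k * f i) = (fun A => k * partial_sum f A).
  by apply/funext => A /=; rewrite /partial_sum mulr_sumr.
exact.
Qed.

Lemma has_sum_finite I (f : I -> R) (A : {fset I}) :
  (forall i, i \notin A -> f i = 0) -> has_sum f (\sum_(i <- A) f i).
Proof.
move=> f0; apply/has_sumP => e e0; exists A => B AB.
rewrite (big_fset_incl _ AB) ?subrr ?normr0 // => i _ /f0.
exact.
Qed.

Lemma has_sum_single I (f : I -> R) (i0 : I) :
  (forall i, i != i0 -> f i = 0) -> has_sum f (f i0).
Proof.
move=> f0; have := @has_sum_finite _ f [fset i0]%fset.
by rewrite big_seq_fset1; apply => i; rewrite inE => /f0.
Qed.

Lemma has_sum_eq0 I (f : I -> R) : f =1 (fun=> 0) -> has_sum f 0.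
Proof.
move=> f0; have := @has_sum_finite _ f fset0.
by rewrite big_seq_fset0; apply => i _; exact: f0.
Qed.

Lemma has_sum_le I (f : I -> R) (l C : R) (A : {fset I}) :
  (forall B : {fset I}, (A `<=` B)%fset -> \sum_(i <- B) f i <= C) ->
  has_sum f l -> l <= C.
Proof.
move=> fC /has_sumP h; apply/ler_addgt0Pr => e /h[A' hA'].
have := hA' _ (fsubsetUr A A'); rewrite ltr_norml => /andP[_].
rewrite ltrBlDr addrC => /ltW /le_trans; apply.
by rewrite lerD2r; apply/fC/fsubsetUl.
Qed.

Lemma has_sum_ge I (f : I -> R) (l C : R) (A : {fset I}) :
  (forall B : {fset I}, (A `<=` B)%fset -> C <= \sum_(i <- B) f i) ->
  has_sum f l -> C <= l.
Proof.
move=> fC /(has_sumZ (k := -1)) h; rewrite -lerN2 -(mulN1r l).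
apply: (has_sum_le (A := A)) h => B /fC hB.
by rewrite -mulr_sumr mulN1r lerN2.
Qed.

Lemma has_sum_ge0_bound I (f : I -> R) (l : R) (A : {fset I}) :
  (forall i, 0 <= f i) -> has_sum f l -> \sum_(i <- A) f i <= l.
Proof. by move=> f0; apply: (has_sum_ge (A := A)) => B AB; apply: ler_sum_sub => //; exact/fsubsetP. Qed.

Lemma has_sum_norm_le I (f : I -> R) (l C : R) :
  abs_bounded f C -> has_sum f l -> `|l| <= C.
Proof.
move=> fC h; have hC (B : {fset I}) : `|\sum_(i <- B) f i| <= C.
  by apply: le_trans (fC B); exact: ler_norm_sum.
rewrite ler_norml; apply/andP; split.
  by apply: (has_sum_ge (A := fset0)) h => B _; have := hC B; rewrite ler_norml => /andP[].
by apply: (has_sum_le (A := fset0)) h => B _; apply: le_trans (hC B); exact: ler_norm.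
Qed.

Lemma abs_boundedW I (f g : I -> R) (C : R) :
  (forall i, `|f i| <= `|g i|) -> abs_bounded g C -> abs_bounded f C.
Proof. by move=> fg gC A; apply: le_trans (gC A); apply: ler_sum. Qed.

(** The supremum of the finite partial sums is the sum: monotonicity keeps all larger sets as close
    to it as one that comes within [e]. *)
Lemma has_sum_ge0_ex I (f : I -> R) (C : R) :
  (forall i, 0 <= f i) -> abs_bounded f C -> exists l, has_sum f l.
Proof.
move=> f0 fC; pose E := [set \sum_(i <- A) f i | A in [set: {fset I}]].
have fC' (A : {fset I}) : \sum_(i <- A) f i <= C.
  by apply: le_trans (fC A); apply: ler_sum => i _; rewrite ler_norm.
have supE : has_sup E.
  split; first by exists (\sum_(i <- (fset0 : {fset I})) f i), fset0.
  by exists C => _ [A _ <-].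
exists (sup E); apply/has_sumP => e e0.
have [_ [A _ <-] hA] := sup_adherent e0 supE.
exists A => B AB.
have AB' : \sum_(i <- A) f i <= \sum_(i <- B) f i by apply: ler_sum_sub => //; exact/fsubsetP.
have Bs : \sum_(i <- B) f i <= sup E by apply: ub_le_sup; [exact: supE.2 | exists B].
by rewrite ger0_norm ?subr_ge0 // ltrBlDr addrC -ltrBlDr; apply: lt_le_trans AB'.
Qed.

(** [f] is the difference of [|f| + f] and [|f|], both nonnegative and bounded. *)
Lemma abs_bounded_has_sum I (f : I -> R) (C : R) :
  abs_bounded f C -> exists l, has_sum f l.
Proof.
move=> fC.
have [l hl] : exists l, has_sum (fun i => `|f i|) l.
  by apply: (@has_sum_ge0_ex _ _ C) => // A; under eq_bigr do rewrite normr_id.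
have [l' hl'] : exists l, has_sum (fun i => `|f i| + f i) l.
  apply: (@has_sum_ge0_ex _ _ (C + C)) => [i|A].
    by have := ler_norm (- f i); rewrite normrN -subr_ge0 opprK addrC.
  apply: le_trans (lerD (fC A) (fC A)); rewrite -big_split; apply: ler_sum => i _.
  by rewrite (le_trans (ler_normD _ _)) // normr_id.
exists (l' + -1 * l); apply: (eq_has_sum _ (has_sumD hl' (has_sumZ (k := -1) hl))).
by move=> i; rewrite mulN1r addrAC subrr add0r.
Qed.

Lemma has_sum_bigop I (T : eqType) (s : seq T) (F : T -> I -> R) (L : T -> R) :
  (forall t, has_sum (F t) (L t)) ->
  has_sum (fun i => \sum_(t <- s) F t i) (\sum_(t <- s) L t).
Proof.
move=> h; elim: s => [|t s IH].
  by rewrite big_nil; apply: has_sum_eq0 => i; rewrite big_nil.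
rewrite big_cons; apply: (eq_has_sum _ (has_sumD (h t) IH)) => i.
by rewrite big_cons.
Qed.

(** Summation by fibres of [p]. If [A] controls [f] up to [e / 2] and [S] contains [p(A)], then for
    every [B] containing [A] the part of [B] above [S] still contains [A], so its sum is within
    [e / 2] of [l]. Letting [B] grow turns that sum into the sum of [g] over [S]. *)
Lemma has_sum_fibres I K (p : K -> I) (f : K -> R) (g : I -> R) (l : R) :
  has_sum f l ->
  (forall i, has_sum (fun k => if p k == i then f k else 0) (g i)) ->
  has_sum g l.
Proof.
move=> /has_sumP fl rows; apply/has_sumP => e e0.
have [A hA] := fl _ (divr_gt0 e0 (ltr0Sn R 1)).
exists [fset p k | k in A]%fset => S AS.
have hS := @has_sum_bigop _ _ (enum_fset S) _ _ rows.
(* The limit over [B] preserves weak inequalities only, hence [e / 2] instead of [e]. *)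
apply: (@le_lt_trans _ _ (e / 2)); last by rewrite ltr_pdivrMr // ltr_pMr // ltr1n.
have Sle B : (A `<=` B)%fset ->
    `|l - \sum_(k <- B) \sum_(i <- S) (if p k == i then f k else 0)| < e / 2.
  move=> AB; rewrite [X in _ - X](_ : _ = \sum_(k <- [fset k in B | p k \in S]%fset) f k).
    apply: hA; apply/fsubsetP => k kA; rewrite !inE /= (fsubsetP AB) //=.
    by apply: (fsubsetP AS); apply/imfsetP; exists k.
  rewrite [RHS]big_fset /= [RHS]big_mkcond /=.
  apply: eq_bigr => k _; case: ifPn => [kS|kS].
    rewrite (big_fsetD1 _ kS) /= eqxx big1_fset ?addr0 // => i.
    by rewrite !inE eq_sym => /andP[/negbTE ->].
  by rewrite big1_fset // => i iS _; case: eqP => // pk; rewrite pk iS in kS.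
rewrite ler_distl; apply/andP; split.
  rewrite lerBlDr; apply: (has_sum_le (A := A)) hS => B /Sle /ltW.
  by rewrite ler_distl lerBlDr => /andP[].
rewrite -lerBlDr; apply: (has_sum_ge (A := A)) hS => B /Sle /ltW.
by rewrite ler_distl -lerBlDr => /andP[].
Qed.

Lemma has_sum_inj I K (h : K -> I) (f : I -> R) (l : R) : injective h ->
  (forall i, (forall k, h k != i) -> f i = 0) ->
  has_sum (f \o h) l -> has_sum f l.
Proof.
move=> hinj f0 hf; apply: (has_sum_fibres hf (p := h)) => i.
have [[k <-]|nk] := pselect (exists k, h k = i).
  have := @has_sum_single _ (fun k' => if h k' == h k then (f \o h) k' else 0) k.
  by rewrite eqxx; apply => k' kk'; case: eqP => // /hinj kk; rewrite kk eqxx in kk'.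
rewrite f0; last by move=> k; apply/eqP => hk; apply: nk; exists k.
by apply: has_sum_eq0 => k; case: eqP => // hk; case: nk; exists k.
Qed.

Lemma has_sum_prod_rows I K (f : I * K -> R) (g : I -> R) (l : R) :
  has_sum f l -> (forall i, has_sum (fun k => f (i, k)) (g i)) -> has_sum g l.
Proof.
move=> fl rows; apply: (has_sum_fibres (p := fst) fl) => i.
apply: (@has_sum_inj _ _ (fun k => (i, k))) => [k k' [] //||].
  by case=> i' k /(_ k) /=; case: (eqVneq i' i) => // ->; rewrite eqxx.
by apply: eq_has_sum (rows i) => k /=; rewrite eqxx.
Qed.

(** A finite set of pairs lies in the rectangle spanned by its two projections, where the sum can be
    taken row by row. *)
Lemma abs_bounded_prod I K (f : I * K -> R) (c : I -> R) (C : R) :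
  (forall i, abs_bounded (fun k => f (i, k)) (c i)) -> abs_bounded c C ->
  abs_bounded f C.
Proof.
move=> fc cC A; pose S := [fset x.1 | x in A]%fset; pose T := [fset x.2 | x in A]%fset.
apply: le_trans (cC S).
apply: (@le_trans _ _ (\sum_(i <- S) \sum_(k <- T) `|f (i, k)|)); last first.
  by apply: ler_sum => i _; apply: le_trans (fc i T) _; exact: ler_norm.
rewrite -(big_allpairs (F := fun x => `|f x|)); apply: ler_sum_sub => //.
  by apply: allpairs_uniq => // -[i k] [i' k'].
case=> i k ikA; apply/allpairsP; exists (i, k); split => //.
  by apply/imfsetP; exists (i, k).
by apply/imfsetP; exists (i, k).
Qed.

Lemma abs_bounded_ge0 I (f : I -> R) (C : R) : abs_bounded f C -> 0 <= C.
Proof. by move=> /(_ fset0); rewrite big_seq_fset0. Qed.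

Lemma abs_boundedZ I (f : I -> R) (C k : R) :
  abs_bounded f C -> abs_bounded (fun i => k * f i) (`|k| * C).
Proof.
move=> fC A; under eq_bigr do rewrite normrM.
by rewrite -mulr_sumr ler_wpM2l.
Qed.

Lemma abs_boundedM I K (f : I -> R) (g : K -> R) (C D : R) :
  abs_bounded f C -> abs_bounded g D ->
  abs_bounded (fun p : I * K => f p.1 * g p.2) (C * D).
Proof.
move=> fC gD; apply: (@abs_bounded_prod _ _ _ (fun i => `|f i| * D)) => [i|A].
  exact: (abs_boundedZ (f i) gD).
under eq_bigr do rewrite normrM normr_id (ger0_norm (abs_bounded_ge0 gD)).
by rewrite -mulr_suml ler_wpM2r // (abs_bounded_ge0 gD).
Qed.

(** The product family is absolutely summable, so it has a sum; summing by rows identifies it. *)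
Lemma has_sumM I K (f : I -> R) (g : K -> R) (C D l l' : R) :
  abs_bounded f C -> abs_bounded g D -> has_sum f l -> has_sum g l' ->
  has_sum (fun p : I * K => f p.1 * g p.2) (l * l').
Proof.
move=> fC gD fl gl'; have [L hL] := abs_bounded_has_sum (abs_boundedM fC gD).
have hf := has_sum_prod_rows hL (fun i => has_sumZ (k := f i) gl').
have <- // : L = l * l'.
rewrite mulrC; apply: has_sum_unique hf _.
by apply: eq_has_sum (has_sumZ (k := l') fl) => i; rewrite mulrC.
Qed.

Lemma fset_nat_bound (A : {fset nat}) :
  exists N, forall n, (N <= n)%N -> {subset A <= index_iota 0 n}.
Proof.
exists (\max_(i <- A) i).+1 => n Nn i iA; rewrite mem_index_iota /=.
by apply: leq_trans Nn; rewrite ltnS; apply: leq_bigmax_seq.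
Qed.

Lemma has_sum_cvg_series (u : nat -> R) (l : R) :
  has_sum u l -> series u @ \oo --> l.
Proof.
move=> /has_sumP h; apply/cvgrPdist_lt => e /h [A hA].
have [N hN] := fset_nat_bound A.
exists N => //= n /= Nn; have := hA [fset i | i in index_iota 0 n]%fset.
rewrite (perm_big (index_iota 0 n)) /=; last first.
  by apply: uniq_perm; rewrite ?fset_uniq ?iota_uniq // => i; rewrite !inE.
by apply; apply/fsubsetP => i iA; rewrite !inE /= (hN n Nn i iA).
Qed.

Lemma abs_bounded_nat (u : nat -> R) (C : R) :
  (forall n, \sum_(0 <= i < n) `|u i| <= C) -> abs_bounded u C.
Proof.
move=> uC A; have [N hN] := fset_nat_bound A.
apply: le_trans (uC N); apply: ler_sum_sub => //; last exact: hN.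
exact: iota_uniq.
Qed.


End has_sum_theory.

(** * Power series in several variables *)

Definition monomial (R : realType) (J : finType) (u : J -> R)
    (al : {ffun J -> nat}) : R := \prod_j u j ^+ al j.

Definition in_box (R : realType) (J : finType) (a : J -> R) (r : R)
    (x : J -> R) : Prop := forall j, `|x j - a j| < r.

(* [C] bounds the weighted l1 norm of the coefficients, which is complete and
   submultiplicative for each fixed [r]: closure under composition with a
   one-variable power series reduces to bounding norms. *)
Definition power_series_bound (R : realType) (J : finType) (a : J -> R)
    (r C : R) (f : (J -> R) -> R) : Prop :=
  exists2 c : {ffun J -> nat} -> R,
    abs_bounded (fun al => c al * monomial (fun=> r) al) C &
    forall x, in_box a r x ->
      has_sum (fun al => c al * monomial (fun j => x j - a j) al) (f x).

Section power_series.
Variables (R : realType) (J : finType).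
Implicit Types (a x : J -> R) (f g : (J -> R) -> R) (al : {ffun J -> nat}).

Lemma monomialD (u : J -> R) (al be : {ffun J -> nat}) :
  monomial u [ffun j => al j + be j]%N = monomial u al * monomial u be.
Proof.
by rewrite -big_split /=; apply: eq_bigr => j _; rewrite ffunE exprD.
Qed.

Lemma monomial0 (u : J -> R) : monomial u [ffun=> 0%N] = 1.
Proof. by rewrite /monomial big1 // => j _; rewrite ffunE. Qed.

Lemma monomial1 (u : J -> R) (j : J) :
  monomial u [ffun i => (i == j) : nat] = u j.
Proof.
rewrite /monomial (bigD1 j) //= ffunE eqxx expr1 big1 ?mulr1 // => i /negbTE ij.
by rewrite ffunE ij.
Qed.

Lemma monomial_ge0 (r : R) al : 0 <= r -> 0 <= monomial (fun=> r) al.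
Proof. by move=> r0; apply: prodr_ge0 => j _; exact: exprn_ge0. Qed.

Lemma monomial_gt0 (r : R) al : 0 < r -> 0 < monomial (fun=> r) al.
Proof. by move=> r0; apply: prodr_gt0 => j _; exact: exprn_gt0. Qed.

Lemma monomial_le (u : J -> R) (r : R) al :
  (forall j, `|u j| <= r) -> `|monomial u al| <= monomial (fun=> r) al.
Proof.
move=> ur; rewrite normr_prod; apply: ler_prod => j _; rewrite normr_ge0 normrX.
by apply: lerXn2r => //; rewrite nnegrE // (le_trans _ (ur j)).
Qed.

Lemma monomial_scale (r t : R) al :
  monomial (fun=> t * r) al = monomial (fun=> t) al * monomial (fun=> r) al.
Proof. by rewrite -big_split; apply: eq_bigr => j _; rewrite exprMn. Qed.

Lemma monomial_le1 (t : R) al : 0 <= t <= 1 -> al != [ffun=> 0%N] ->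
  monomial (fun=> t) al <= t.
Proof.
move=> /andP[t0 t1] al0; have [j alj] : exists j, al j != 0%N.
  apply: contrapT => h; case/eqP: al0; apply/ffunP => j; rewrite ffunE.
  by apply/eqP; apply: contrapT => /negP alj; apply: h; exists j.
rewrite /monomial (bigD1 j) //= -[leRHS]mulr1; apply: ler_pM.
- exact: exprn_ge0.
- by apply: prodr_ge0 => i _; exact: exprn_ge0.
- by rewrite -[leRHS]expr1; apply: ler_wiXn2l; rewrite ?t0 ?t1 ?lt0n.
- by apply: prodr_ile1 => i _; rewrite exprn_ge0 // exprn_ile1.
Qed.

(** Collecting like terms: [K] may repeat exponents, and the bound is not made worse. Products and
    infinite sums of power series are reduced to this. *)
Lemma power_series_regroup (K : choiceType) (c : K -> R)
    (al : K -> {ffun J -> nat}) a (r C : R) f : 0 < r ->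
  abs_bounded (fun k => c k * monomial (fun=> r) (al k)) C ->
  (forall x, in_box a r x ->
     has_sum (fun k => c k * monomial (fun j => x j - a j) (al k)) (f x)) ->
  power_series_bound a r C f.
Proof.
move=> r0 cC cf.
(* On the fibre of [m] the weight [monomial (fun=> r) m] is a nonzero constant, so the bare
   coefficients are summable as well. *)
have ex m : exists l, has_sum (fun k => if al k == m then c k else 0) l.
  apply: (@abs_bounded_has_sum _ _ _ (`|(monomial (fun=> r) m)^-1| * C)).
  apply: abs_boundedW (abs_boundedZ _ cC) => k; case: eqP => [->|_].
    by rewrite mulrCA mulVf ?mulr1 // lt0r_neq0 // monomial_gt0.
  by rewrite normr0.
pose c' m := projT1 (cid (ex m)).
have hc' m : has_sum (fun k => if al k == m then c k else 0) (c' m) := projT2 (cid (ex m)).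
have rows (u : J -> R) m : has_sum (fun k => if al k == m then c k * monomial u (al k) else 0)
    (c' m * monomial u m).
  rewrite mulrC; have h := has_sumZ (k := monomial u m) (hc' m).
  apply: eq_has_sum h => k.
  by case: eqP => [->|_]; rewrite ?mulr0 // mulrC.
exists c'; last first.
  by move=> x /cf h; exact: has_sum_fibres h (rows _).
(* The bound survives because [d m], the sum of the absolute values over the fibre of [m], dominates
   the new weighted coefficient, and the [d m] add up to [D <= C]. *)
have [D hD] : exists D, has_sum (fun k => `|c k * monomial (fun=> r) (al k)|) D.
  apply: (@abs_bounded_has_sum _ _ _ C); apply: abs_boundedW cC => k.
  by rewrite normr_id.
have DC : D <= C by apply: (has_sum_le (A := fset0)) hD => B _; exact: cC.
have exd m : exists l, has_sum
    (fun k => if al k == m then `|c k * monomial (fun=> r) (al k)| else 0) l.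
  apply: (@abs_bounded_has_sum _ _ _ C); apply: abs_boundedW cC => k.
  by case: eqP => _; rewrite ?normr_id ?normr0.
pose d m := projT1 (cid (exd m)).
have hd m : has_sum _ (d m) := projT2 (cid (exd m)).
move=> S; apply: le_trans DC.
have dD := has_sum_fibres hD hd.
have cd m : `|c' m * monomial (fun=> r) m| <= d m.
  apply: has_sum_norm_le (rows _ m) => A.
  rewrite (eq_bigr (fun k => if al k == m then `|c k * monomial (fun=> r) (al k)| else 0)).
    by apply: has_sum_ge0_bound (hd m) => k; case: ifP.
  by move=> k _; case: ifP; rewrite ?normr0.
apply: (@le_trans _ _ (\sum_(m <- S) d m)); first by apply: ler_sum.
by apply: has_sum_ge0_bound dD => m; apply: le_trans (cd m).
Qed.

Lemma power_series_eq a (r C : R) f g :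
  (forall x, in_box a r x -> f x = g x) ->
  power_series_bound a r C f -> power_series_bound a r C g.
Proof. by move=> fg [c cC cf]; exists c => // x xr; rewrite -fg //; exact: cf. Qed.

Lemma in_box_le a (r r' : R) x : r' <= r -> in_box a r' x -> in_box a r x.
Proof. by move=> rr xr j; exact: lt_le_trans (xr j) rr. Qed.

Lemma power_series_shrink a (r r' C C' : R) f : 0 <= r' -> r' <= r -> C <= C' ->
  power_series_bound a r C f -> power_series_bound a r' C' f.
Proof.
move=> r0 rr CC [c cC cf]; exists c; last by move=> x /(in_box_le rr) /cf.
move=> A; apply: le_trans CC; move: A; apply: abs_boundedW cC => al.
rewrite !normrM ler_wpM2l // [leRHS]ger0_norm ?monomial_ge0 ?(le_trans r0) //.
by apply: monomial_le => _; rewrite ger0_norm.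
Qed.

Lemma power_series_norm_le a (r C : R) f x :
  power_series_bound a r C f -> in_box a r x -> `|f x| <= C.
Proof.
move=> [c cC cf] xr; apply: has_sum_norm_le (cf x xr).
apply: abs_boundedW cC => al.
have := @monomial_le (fun j => x j - a j) r al (fun j => ltW (xr j)) => h.
by rewrite !normrM ler_wpM2l // (le_trans h) // ler_norm.
Qed.

Lemma power_series_cst a (r k : R) : 0 < r -> power_series_bound a r `|k| (fun=> k).
Proof.
move=> r0; apply: (@power_series_regroup unit (fun=> k) (fun=> [ffun=> 0%N])) => //.
  move=> A; under eq_bigr do rewrite monomial0 mulr1.
  apply: (@le_trans _ _ (\sum_(i <- [:: tt]) `|k|)); last by rewrite big_seq1.
  by apply: (ler_sum_sub (F := fun=> _)) => // -[]; rewrite inE.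
move=> x _; apply: eq_has_sum (@has_sum_single R unit (fun=> k) tt _).
  by move=> i; rewrite monomial0 mulr1.
by case.
Qed.

Lemma power_series_coord a (r : R) (j : J) : 0 < r ->
  power_series_bound a r r (fun x => x j - a j).
Proof.
move=> r0; apply: (@power_series_regroup unit (fun=> 1)
  (fun=> [ffun i => (i == j) : nat])) => //.
  move=> A; under eq_bigr do rewrite monomial1 mul1r (gtr0_norm r0).
  apply: (@le_trans _ _ (\sum_(i <- [:: tt]) r)); last by rewrite big_seq1.
  have r0' := ltW r0.
  by apply: (ler_sum_sub (F := fun=> _)) => // -[]; rewrite inE.
move=> x _; apply: eq_has_sum (@has_sum_single R unit (fun=> x j - a j) tt _).
  by move=> i; rewrite monomial1 mul1r.
by case.
Qed.

Lemma power_seriesD a (r C D : R) f g :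
  power_series_bound a r C f -> power_series_bound a r D g ->
  power_series_bound a r (C + D) (fun x => f x + g x).
Proof.
move=> [c cC cf] [d dD dg]; exists (fun al => c al + d al).
  move=> A; apply: le_trans (lerD (cC A) (dD A)); rewrite -big_split.
  by apply: ler_sum => al _; rewrite mulrDl ler_normD.
move=> x xr; apply: eq_has_sum (has_sumD (cf x xr) (dg x xr)) => al.
by rewrite mulrDl.
Qed.

(** Submultiplicativity of the weighted norm: the product is expanded over pairs of multi-indices,
    then regrouped by their sum. *)
Lemma power_seriesM a (r C D : R) f g : 0 < r ->
  power_series_bound a r C f -> power_series_bound a r D g ->
  power_series_bound a r (C * D) (fun x => f x * g x).
Proof.
move=> r0 [c cC cf] [d dD dg].
have E (u : J -> R) (p : {ffun J -> nat} * {ffun J -> nat}) :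
    c p.1 * monomial u p.1 * (d p.2 * monomial u p.2) =
    c p.1 * d p.2 * monomial u [ffun j => p.1 j + p.2 j]%N.
  by rewrite monomialD mulrACA.
apply: (power_series_regroup (c := fun p => c p.1 * d p.2)
  (al := fun p => [ffun j => p.1 j + p.2 j]%N)) => //.
  by apply: abs_boundedW (abs_boundedM cC dD) => p; rewrite E.
move=> x xr.
have small (b : {ffun J -> nat} -> R) B : abs_bounded (fun al => b al * monomial (fun=> r) al) B ->
    abs_bounded (fun al => b al * monomial (fun j => x j - a j) al) B.
  apply: abs_boundedW => al; rewrite !normrM ler_wpM2l //.
  apply: le_trans (ler_norm _); apply: monomial_le => j; exact: ltW (xr j).
apply: eq_has_sum (has_sumM (small _ _ cC) (small _ _ dD) (cf x xr) (dg x xr)) => p.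
exact: E.
Qed.

(** Completeness of the weighted norm: the double family over [(k, al)] is absolutely summable, so
    it can be summed row by row, which gives [F x], or regrouped by exponents, which gives a power
    series. *)
Lemma power_series_series a (r D : R) (f : nat -> (J -> R) -> R) (F : (J -> R) -> R)
    (C : nat -> R) : 0 < r ->
  (forall k, power_series_bound a r (C k) (f k)) -> abs_bounded C D ->
  (forall x, in_box a r x -> series (fun k => f k x) @ \oo --> F x) ->
  power_series_bound a r D F.
Proof.
move=> r0 fC CD fF.
pose c k := s2val (cid2 (fC k)).
have cC k : abs_bounded (fun al => c k al * monomial (fun=> r) al) (C k) := s2valP (cid2 (fC k)).
have cf k x : in_box a r x ->
    has_sum (fun al => c k al * monomial (fun j => x j - a j) al) (f k x) := s2valP' (cid2 (fC k)) x.
have bound : abs_bounded (fun p : nat * {ffun J -> nat} => c p.1 p.2 * monomial (fun=> r) p.2) D.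
  exact: abs_bounded_prod cC CD.
apply: (power_series_regroup (c := fun p : nat * {ffun J -> nat} => c p.1 p.2) (al := snd)) => //.
move=> x xr.
have [L hL] : exists L, has_sum (fun p : nat * {ffun J -> nat} =>
    c p.1 p.2 * monomial (fun j => x j - a j) p.2) L.
  apply: abs_bounded_has_sum (abs_boundedW _ bound) => p.
  rewrite !normrM ler_wpM2l // (le_trans _ (ler_norm _)) //.
  by apply: monomial_le => j; exact: ltW (xr j).
have := has_sum_prod_rows hL (fun k => cf k x xr).
by move=> /has_sum_cvg_series /(cvg_unique _ (fF x xr)) ->.
Qed.

Lemma power_seriesX a (r C : R) f k : 0 < r ->
  power_series_bound a r C f -> power_series_bound a r (C ^+ k) (fun x => f x ^+ k).
Proof.
move=> r0 fC; elim: k => [|k IH].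
  by have := power_series_cst a 1 r0; rewrite normr1.
rewrite exprS; apply: power_series_eq (power_seriesM r0 fC IH) => x _.
by rewrite exprS.
Qed.

(** Without a constant term every monomial has degree at least 1, so shrinking the radius from [r]
    to [r'] scales the norm by at most [r' / r]. This makes the norm of a function vanishing at [a]
    as small as desired. *)
Lemma power_series_root a (r r' C : R) f : 0 < r' -> r' <= r ->
  power_series_bound a r C f -> f a = 0 ->
  power_series_bound a r' (r' / r * C) f.
Proof.
move=> r'0 rr [c cC cf] fa0; have r0 : 0 < r := lt_le_trans r'0 rr.
(* At the centre all nonconstant monomials vanish, so the constant coefficient is [f a]. *)
have c0 : c [ffun=> 0%N] = 0.
  have := cf a; rewrite fa0 => /(_ _) h.
  have /h : in_box a r a by move=> j; rewrite subrr normr0.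
  have := @has_sum_single R _ (fun al => c al * monomial (fun j => a j - a j) al) [ffun=> 0%N].
  rewrite monomial0 mulr1 => h1 h2; apply: has_sum_unique (h1 _) h2 => al al0.
  apply/eqP; rewrite mulf_eq0; apply/orP; right; rewrite -normr_le0.
  apply: le_trans (@monomial_le _ 0 _ _) _ => [j|]; first by rewrite subrr normr0.
  by apply: monomial_le1; rewrite ?lexx ?ler01.
exists c; last by move=> x /(in_box_le rr) /cf.
have t0 : 0 <= r' / r by rewrite divr_ge0 // ltW.
rewrite -(ger0_norm t0); apply: abs_boundedW (abs_boundedZ _ cC) => al.
have [->|al0] := eqVneq al [ffun=> 0%N]; first by rewrite c0 !mul0r normr0.
rewrite -[X in fun=> X](divfK (lt0r_neq0 r0)) monomial_scale mulrCA !normrM.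
rewrite -(normrM r') ler_wpM2r ?mulr_ge0 // !ger0_norm ?monomial_ge0 // monomial_le1 // t0.
by rewrite ler_pdivrMr // mul1r.
Qed.

End power_series.

(** * Germs of analytic functions and their closure properties *)

(** Radius and bound are hidden, since each operation may shrink the former and enlarge the
    latter. *)
Definition germ (R : realType) (J : finType) (a : J -> R) (f : (J -> R) -> R) : Prop :=
  exists r C, 0 < r /\ power_series_bound a r C f.

Section germ_theory.
Variables (R : realType) (J : finType).
Implicit Types (a x : J -> R) (f g : (J -> R) -> R).

Lemma germ_analytic a f : germ a f -> analytic_at f a.
Proof. by move=> [r [C [r0 [c _ cf]]]]; exists c, r. Qed.

Lemma germ_eq a f g (s : R) : 0 < s -> (forall x, in_box a s x -> f x = g x) ->
  germ a f -> germ a g.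
Proof.
move=> s0 fg [r [C [r0 fC]]]; exists (Num.min r s), C.
have m0 : 0 < Num.min r s by rewrite lt_min r0 s0.
split=> //; apply: power_series_eq (power_series_shrink (ltW m0) _ (lexx C) fC).
  by move=> x xr; apply: fg; apply: in_box_le xr; rewrite ge_min lexx orbT.
by rewrite ge_min lexx.
Qed.

Lemma germ_common (T : eqType) (s : seq T) (f : T -> (J -> R) -> R) a :
  (forall t, t \in s -> germ a (f t)) -> exists r C, 0 < r /\
    forall t, t \in s -> power_series_bound a r C (f t).
Proof.
elim: s => [|t s IH] h; first by exists 1, 0.
have [r [C [r0 hC]]] : exists r C, 0 < r /\
    forall t, t \in s -> power_series_bound a r C (f t).
  by apply: IH => t' t's; apply: h; rewrite inE t's orbT.
have [r' [C' [r'0 hC']]] := h t (mem_head t s).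
have m0 : 0 < Num.min r r' by rewrite lt_min r0 r'0.
exists (Num.min r r'), (Num.max C C'); split=> // t'.
rewrite inE => /predU1P[->|/hC]; apply: power_series_shrink (hC') || apply: power_series_shrink;
  by rewrite ?(ltW m0) ?ge_min ?le_max ?lexx ?orbT.
Qed.

Lemma germ_cst a (k : R) : germ a (fun=> k).
Proof. by exists 1, `|k|; split=> //; exact: power_series_cst. Qed.

Lemma germD a f g : germ a f -> germ a g -> germ a (fun x => f x + g x).
Proof.
move=> fa ga; have [|r [C [r0 h]]] := @germ_common _ [:: true; false] (fun b => if b then f else g) a.
  by case.
exists r, (C + C); split=> //; apply: power_seriesD; first exact: (h true).
exact: (h false).
Qed.

Lemma germM a f g : germ a f -> germ a g -> germ a (fun x => f x * g x).
Proof.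
move=> fa ga; have [|r [C [r0 h]]] := @germ_common _ [:: true; false] (fun b => if b then f else g) a.
  by case.
exists r, (C * C); split=> //; apply: power_seriesM => //; first exact: (h true).
exact: (h false).
Qed.

Lemma germZ a (k : R) f : germ a f -> germ a (fun x => k * f x).
Proof. by move=> fa; apply: germM => //; exact: germ_cst. Qed.

Lemma germB a f g : germ a f -> germ a g -> germ a (fun x => f x - g x).
Proof.
move=> fa ga; apply: (@germ_eq a (fun x => f x + -1 * g x) _ 1) => //.
  by move=> x _; rewrite mulN1r.
by apply: germD => //; exact: germZ.
Qed.

Lemma germ_coord a (j : J) : germ a (fun x => x j).
Proof.
apply: (@germ_eq a (fun x => (x j - a j) + a j) _ 1) => //.
  by move=> x _; rewrite subrK.
apply: germD (germ_cst _ _); exists 1, 1; split=> //.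
exact: power_series_coord.
Qed.

Lemma germ_sum (T : eqType) (s : seq T) (f : T -> (J -> R) -> R) a :
  (forall t, germ a (f t)) -> germ a (fun x => \sum_(t <- s) f t x).
Proof.
move=> h; elim: s => [|t s IH].
  by under eq_fun do rewrite big_nil; exact: germ_cst.
by under eq_fun do rewrite big_cons; exact: germD.
Qed.

(** As [f] vanishes at [a], a smaller radius brings its norm below [rho]; the norm of
    [phi k * f ^ k] is then at most [|phi k| * rho ^ k], and completeness applies. *)
Lemma germ_comp a f (phi : nat -> R) (rho B : R) (F : R -> R) : 0 < rho ->
  abs_bounded (fun k => phi k * rho ^+ k) B ->
  (forall t, `|t| <= rho -> series (fun k => phi k * t ^+ k) @ \oo --> F t) ->
  germ a f -> f a = 0 -> germ a (F \o f).
Proof.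
move=> rho0 phiB phiF [r [C [r0 fC]]] fa0.
have C0 : 0 <= C by case: fC => c /abs_bounded_ge0.
(* Chosen so that [r' / r * C <= rho]; the [+ 1] guards against [C = 0]. *)
pose r' := Num.min r (r * rho / (C + 1)).
have C1 : 0 < C + 1 by rewrite ltr_wpDl.
have r'0 : 0 < r' by rewrite lt_min r0 divr_gt0 // mulr_gt0.
have r'r : r' <= r by rewrite ge_min lexx.
have frho : power_series_bound a r' rho f.
  apply: power_series_shrink (power_series_root r'0 r'r fC fa0) => //; first exact: ltW.
  have : r' <= r * rho / (C + 1) by rewrite ge_min lexx orbT.
  rewrite ler_pdivlMr // mulrC => h; rewrite mulrAC ler_pdivrMr // [rho * _]mulrC.
  by apply: le_trans h; rewrite mulrDl mul1r mulrC lerDl ltW.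
exists r', B; split=> //.
apply: (power_series_series (f := fun k x => phi k * f x ^+ k) (C := fun k => `|phi k * rho ^+ k|)) => //.
- move=> k; rewrite normrM; apply: power_seriesM (power_series_cst _ _ _) _ => //.
  by rewrite ger0_norm ?exprn_ge0 ?ltW //; exact: power_seriesX.
- by apply: abs_boundedW phiB => k; rewrite normr_id.
- by move=> x xr; apply: phiF; exact: power_series_norm_le xr.
Qed.

End germ_theory.

(** * The exponential of upper triangular matrices *)

Section matrix_exp.
Variables (R : realType) (n : nat).
Implicit Types (A B P Q X Y T : 'M[R]_n) (i j : 'I_n).

Lemma cvg_expR_series (x : R) : series (fun k => k`!%:R^-1 * x ^+ k) @ \oo --> expR x.
Proof.
rewrite (_ : (fun k => _) = exp_coeff x); last by rewrite exp_coeffE.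
exact: is_cvg_series_exp_coeff.
Qed.

Lemma cvg_series_unique (u : nat -> R) (l l' : R) :
  series u @ \oo --> l -> series u @ \oo --> l' -> l = l'.
Proof. exact: cvg_unique. Qed.

Lemma abs_bounded_expR (D : R) : 0 <= D ->
  abs_bounded (fun k => k`!%:R^-1 * D ^+ k) (expR D).
Proof.
move=> D0; apply: abs_bounded_nat => m.
under eq_bigr do rewrite ger0_norm ?mulr_ge0 ?invr_ge0 ?exprn_ge0 //.
have nd : nondecreasing_seq (series (fun k => k`!%:R^-1 * D ^+ k)).
  apply/nondecreasing_seqP => k; rewrite /series /= big_nat_recr //= lerDl.
  by rewrite mulr_ge0 ?invr_ge0 ?exprn_ge0.
have cvgD := @cvg_expR_series D.
by rewrite -(cvg_lim _ cvgD) //; apply: nondecreasing_cvgn_le nd _ m; apply: cvgP cvgD.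
Qed.

Lemma exprmx_norm_le A (c : R) : (forall i j, `|A i j| <= c) ->
  forall k i j, `|(A ^+ k) i j| <= (n%:R * c) ^+ k.
Proof.
move=> Ac; elim=> [|k IH] i j.
  by rewrite !expr0 mxE; case: eqP; rewrite ?normr1 ?normr0.
rewrite exprSr mxE; apply: le_trans (ler_norm_sum _ _ _) _.
apply: (@le_trans _ _ (\sum_(l < n) (n%:R * c) ^+ k * c)).
  by apply: ler_sum => l _; rewrite normrM ler_pM.
by rewrite sumr_const card_ord exprSr -mulrnAr (mulr_natl c).
Qed.

(** The limit in [expmx] is taken in the matrix norm, the largest modulus of an entry. It is
    identified entry by entry, each series being dominated by that of [expR (n * c)], where [c]
    bounds the entries of [A]. *)
Lemma cvg_expmx_entry A i j :
  series (fun k => k`!%:R^-1 * (A ^+ k) i j) @ \oo --> expmx A i j.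
Proof.
pose c := \big[Num.max/0]_(p : 'I_n * 'I_n) `|A p.1 p.2|.
have Ac i' j' : `|A i' j'| <= c by exact: (le_bigmax _ (fun p => `|A p.1 p.2|) (i', j')).
have D0 : 0 <= n%:R * c by rewrite mulr_ge0 // (le_trans _ (Ac i j)).
have cvgA i' j' : exists l : R, series (fun k => k`!%:R^-1 * (A ^+ k) i' j') @ \oo --> l.
  have [l hl] : exists l, has_sum (fun k => k`!%:R^-1 * (A ^+ k) i' j') l.
    apply: abs_bounded_has_sum (abs_boundedW _ (abs_bounded_expR D0)) => k.
    rewrite !normrM ler_wpM2l // (le_trans (exprmx_norm_le Ac k i' j')) //.
    exact: ler_norm.
  by exists l; exact: has_sum_cvg_series.
pose L := \matrix_(i', j') projT1 (cid (cvgA i' j')).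
suff AL : series (fun k => k`!%:R^-1 *: A ^+ k) @ \oo --> L.
  rewrite /expmx (cvg_lim _ AL) // mxE; exact: projT2 (cid (cvgA i j)).
apply/cvgrPdist_le => /= e e0; near=> N.
rewrite /Num.Def.normr /= mx_normrE (bigmax_le _ (ltW e0)) //= => p _.
rewrite !mxE /= summxE.
under eq_bigr do rewrite mxE.
(* There are finitely many entries, so one rank [N] serves them all. *)
move: p; near: N; apply: filter_forall => /= p.
exact: ((cvgrPdist_le _ _).1 (projT2 (cid (cvgA p.1 p.2)))).
Unshelve. all: by end_near. Qed.

Lemma utP A : ut A <-> forall i j, (j < i)%N -> A i j = 0.
Proof.
split=> [/is_trig_mxP h i j ji|h]; first by have := h _ _ ji; rewrite mxE.
by apply/is_trig_mxP => i j ij; rewrite mxE h.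
Qed.

(** The entries known after [d] steps of the induction on superdiagonals: for upper triangular
    matrices [d = 0] says nothing, and [d = n] is equality. *)
Definition agree (d : nat) P Q := forall i j, (j < i + d)%N -> P i j = Q i j.

Lemma ut_mulmx P Q : ut P -> ut Q -> ut (P *m Q).
Proof.
move=> /utP hP /utP hQ; apply/utP => i j ji; rewrite mxE big1 // => l _.
have [li|il] := ltnP l i; first by rewrite hP ?mul0r.
by rewrite hQ ?mulr0 //; apply: leq_trans ji il.
Qed.

Lemma mulmx_diag P Q i : ut P -> ut Q -> (P *m Q) i i = P i i * Q i i.
Proof.
move=> /utP hP /utP hQ; rewrite mxE (bigD1 i) //= big1 ?addr0 // => l li.
have [lti|il] := ltnP l i; first by rewrite hP ?mul0r.
by rewrite hQ ?mulr0 // ltn_neqAle eq_sym li.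
Qed.

(** A nonzero term [P i l * Q l j] has [i <= l <= j], so both factors are at most as far from the
    diagonal as the entry [(i, j)]. *)
Lemma mulmx_agree d P P' Q Q' : ut P -> ut P' -> ut Q -> ut Q' ->
  agree d P P' -> agree d Q Q' -> agree d (P *m Q) (P' *m Q').
Proof.
move=> /utP hP /utP hP' /utP hQ /utP hQ' PP QQ i j ij; rewrite !mxE.
apply: eq_bigr => l _.
have [li|il] := ltnP l i; first by rewrite hP // hP' // !mul0r.
have [jl|lj] := ltnP j l; first by rewrite hQ // hQ' // !mulr0.
by rewrite PP ?QQ //; lia.
Qed.

(** Among the terms with [i <= l <= j] only [l = i] and [l = j] involve the [d]-th superdiagonal;
    the diagonal entries agree because [d > 0]. *)
Lemma mulmx_top d P P' Q Q' i j : (0 < d)%N -> ut P -> ut P' -> ut Q -> ut Q' ->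
  agree d P P' -> agree d Q Q' -> j = (i + d)%N :> nat ->
  (P *m Q) i j = (P' *m Q') i j + (P i j - P' i j) * Q j j + P i i * (Q i j - Q' i j).
Proof.
move=> d0 /utP hP /utP hP' /utP hQ /utP hQ' PP QQ ij; rewrite !mxE.
have ji : j != i by apply/eqP => /(congr1 val) /=; lia.
rewrite !(bigD1 i (P := predT)) //= !(bigD1 j (P := fun l => l != i)) //=.
have -> : \sum_(l | (l != i) && (l != j)) P i l * Q l j =
    \sum_(l | (l != i) && (l != j)) P' i l * Q' l j.
  apply: eq_bigr => l /andP[/eqP li /eqP lj].
  have li' : (l : nat) <> i by move=> h; apply: li; apply: val_inj.
  have lj' : (l : nat) <> j by move=> h; apply: lj; apply: val_inj.
  have [lti|il] := ltnP l i; first by rewrite hP // hP' // !mul0r.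
  have [jl|lj''] := ltnP j l; first by rewrite hQ // hQ' // !mulr0.
  by rewrite PP ?QQ //; lia.
rewrite -(PP i i) ?(QQ j j); [ring|lia|lia].
Qed.

Lemma ut_exprmx A k : ut A -> ut (A ^+ k).
Proof.
move=> hA; elim: k => [|k IH]; last by rewrite exprSr; exact: ut_mulmx.
by apply/utP => i j ji; rewrite expr0 mxE; case: eqP => // ij; rewrite ij ltnn in ji.
Qed.

Lemma exprmx_diag A k i : ut A -> (A ^+ k) i i = A i i ^+ k.
Proof.
move=> hA; elim: k => [|k IH]; first by rewrite !expr0 mxE eqxx.
by rewrite !exprSr -IH -mulmx_diag //; exact: ut_exprmx.
Qed.

Lemma exprmx_agree d A B k : ut A -> ut B -> agree d A B -> agree d (A ^+ k) (B ^+ k).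
Proof.
move=> hA hB AB; elim: k => [|k IH]; first by move=> i j _; rewrite !expr0.
by rewrite !exprSr; apply: mulmx_agree => //; exact: ut_exprmx.
Qed.

(** The divided difference of [t ^ k] at [x] and [y], in the polynomial form that covers [x = y]; it
    is an empty sum for [k = 0]. *)
Definition pow_quot (x y : R) (k : nat) : R := \sum_(l < k) x ^+ (k.-1 - l) * y ^+ l.

Lemma pow_quotS (x y : R) k : pow_quot x y k.+1 = pow_quot x y k * y + x ^+ k.
Proof.
rewrite /pow_quot big_ord_recl /= subn0 expr0 mulr1 addrC; congr (_ + _).
rewrite mulr_suml; apply: eq_bigr => l _; rewrite -mulrA -exprSr /bump /= add1n.
by congr (_ ^+ _ * _); have := ltn_ord l; lia.
Qed.

(** The recursion for the coefficient given by [mulmx_top] is that of the divided differences,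
    [pow_quotS]. *)
Lemma exprmx_top d A B k i j : (0 < d)%N -> ut A -> ut B -> agree d A B ->
  j = (i + d)%N :> nat ->
  (A ^+ k) i j = (B ^+ k) i j + pow_quot (A i i) (A j j) k * (A i j - B i j).
Proof.
move=> d0 hA hB AB ij; elim: k => [|k IH].
  by rewrite !expr0 /pow_quot big_ord0 mul0r addr0.
rewrite !exprSr (mulmx_top d0 (ut_exprmx k hA) (ut_exprmx k hB) hA hB _ AB ij).
  rewrite IH pow_quotS exprmx_diag //; ring.
exact: exprmx_agree.
Qed.

Definition expR_quot (x y : R) : R :=
  if x == y then expR x else (expR x - expR y) / (x - y).

(** The exponential is strictly increasing. This positivity is what makes the equation on each
    superdiagonal uniquely solvable. *)
Lemma expR_quot_gt0 (x y : R) : 0 < expR_quot x y.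
Proof.
rewrite /expR_quot; case: eqP => [_|/eqP xy]; first exact: expR_gt0.
case/lt_total/orP: xy => xy.
  by rewrite -opprB -(opprB y) invrN mulrNN divr_gt0 // subr_gt0 // ltr_expR.
by rewrite divr_gt0 // subr_gt0 // ltr_expR.
Qed.

Lemma cvg_expR_quot (x y : R) :
  series (fun k => k`!%:R^-1 * pow_quot x y k) @ \oo --> expR_quot x y.
Proof.
rewrite /expR_quot; case: eqP => [<-|/eqP xy].
  (* The term [k = 0] is zero; after the shift, the [k + 1] equal summands [x ^ k] turn
     [1 / (k + 1)!] into [1 / k!]. *)
  rewrite -(cvg_shiftS _).
  have -> : (fun N => series (fun k => k`!%:R^-1 * pow_quot x x k) N.+1) =
      series (fun k => k`!%:R^-1 * x ^+ k).
    apply/funext => N; rewrite /series /= big_nat_recl //= {1}/pow_quot big_ord0 mulr0 add0r.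
    apply: eq_bigr => k _; rewrite /pow_quot /=.
    rewrite (eq_bigr (fun=> x ^+ k)) => [|l _]; last by rewrite -exprD subnK // -ltnS.
    rewrite sumr_const card_ord factS natrM invfM -(mulr_natl (x ^+ k)) mulrA; congr (_ * _).
    by rewrite mulrAC mulVf ?mul1r // pnatr_eq0.
  exact: cvg_expR_series.
have -> : series (fun k => k`!%:R^-1 * pow_quot x y k) =
    fun N => (series (fun k => k`!%:R^-1 * x ^+ k) N - series (fun k => k`!%:R^-1 * y ^+ k) N) / (x - y).
  apply/funext => N; rewrite /series /= -sumrB mulr_suml; apply: eq_bigr => k _.
  rewrite -mulrBr subrXX -mulrA; congr (_ * _).
  by rewrite mulrAC mulfV ?mul1r // subr_eq0.
by apply: cvgMr_tmp; apply: cvgB; exact: cvg_expR_series.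
Qed.

Lemma ut_expmx A : ut A -> ut (expmx A).
Proof.
move=> hA; apply/utP => i j ji; apply: cvg_series_unique (@cvg_expmx_entry A i j) _.
rewrite (_ : series _ = fun=> 0); first exact: cvg_cst.
apply/funext => N; rewrite /series /= big1 // => k _.
by have /utP -> := ut_exprmx k hA; rewrite ?mulr0.
Qed.

Lemma expmx_diag A i : ut A -> expmx A i i = expR (A i i).
Proof.
move=> hA; apply: cvg_series_unique (@cvg_expmx_entry A i i) _.
by under eq_fun do rewrite exprmx_diag //; exact: cvg_expR_series.
Qed.

Lemma expmx_agree d A B : ut A -> ut B -> agree d A B -> agree d (expmx A) (expmx B).
Proof.
move=> hA hB AB i j ij; apply: cvg_series_unique (@cvg_expmx_entry A i j) _.
by under eq_fun do rewrite (exprmx_agree _ hA hB AB ij); exact: cvg_expmx_entry.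
Qed.

(** Summing [exprmx_top] over [k] turns the divided differences of the powers into that of the
    exponential. *)
Lemma expmx_top d A B i j : (0 < d)%N -> ut A -> ut B -> agree d A B ->
  j = (i + d)%N :> nat ->
  expmx A i j = expmx B i j + expR_quot (A i i) (A j j) * (A i j - B i j).
Proof.
move=> d0 hA hB AB ij; apply: cvg_series_unique (@cvg_expmx_entry A i j) _.
rewrite (_ : series _ = series (fun k => k`!%:R^-1 * (B ^+ k) i j) +
  (fun N => series (fun k => k`!%:R^-1 * pow_quot (A i i) (A j j) k) N * (A i j - B i j))).
  apply: cvgD; first exact: cvg_expmx_entry.
  by apply: cvgMr_tmp; exact: cvg_expR_quot.
apply/funext => N; transitivity (series (fun k => k`!%:R^-1 * (B ^+ k) i j) N +
  series (fun k => k`!%:R^-1 * pow_quot (A i i) (A j j) k) N * (A i j - B i j)) => //.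
rewrite /series /= mulr_suml -big_split /=.
apply: eq_bigr => k _; rewrite (exprmx_top k d0 hA hB AB ij); ring.
Qed.

End matrix_exp.

(** * Analytic functions *)

Section germ_functions.
Variables (R : realType) (J : finType).
Implicit Types (a x : J -> R) (f g : (J -> R) -> R).

Lemma abs_bounded_half : abs_bounded (fun k => (2^-1 : R) ^+ k) 2.
Proof.
apply: abs_bounded_nat => m.
suff -> : \sum_(0 <= i < m) `|(2^-1 : R) ^+ i| = 2 - 2 * 2^-1 ^+ m.
  by rewrite lerBlDr lerDl mulr_ge0 // exprn_ge0.
elim: m => [|m IH]; first by rewrite big_nil expr0 mulr1 subrr.
rewrite big_nat_recr //= IH ger0_norm ?exprn_ge0 // exprS; field => //.
Qed.

(** With [t = f x / f a - 1], which vanishes at [a], the inverse of [f x] is that of [f a] times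
    that of [1 + t]. The geometric series in [- t] is used with radius [1/2], where its absolute
    values sum to 2. *)
Lemma germV a f : germ a f -> f a != 0 -> germ a (fun x => (f x)^-1).
Proof.
move=> fa fa0.
apply: (@germ_eq _ _ a (fun x => (f a)^-1 * ((fun t => (1 + t)^-1) \o (fun x => f x * (f a)^-1 - 1)) x) _ 1) => //.
  by move=> x _ /=; rewrite addrC subrK invfM invrK mulrCA mulVf // mulr1.
apply: germZ; apply: (@germ_comp _ _ a _ (fun k => (-1) ^+ k) 2^-1 2) => //.
- by apply: abs_boundedW abs_bounded_half => k; rewrite normrM normrX normrN1 expr1n mul1r.
- move=> t th; rewrite (_ : (fun k => _) = geometric 1 (- t)).
    rewrite -[(1 + t)^-1]mul1r -{2}(opprK t); apply: cvg_geometric_series.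
    by rewrite normrN (le_lt_trans th) // invf_lt1 // ltr1n.
  by apply/funext => k; rewrite /geometric /= mul1r (exprNn t).
- apply: germB; last exact: germ_cst.
  by apply: germM => //; exact: germ_cst.
- by rewrite mulfV // subrr.
Qed.

(** Factoring out [expR (f a)] leaves an inner function vanishing at [a], as [germ_comp]
    requires. *)
Lemma germ_expR a f : germ a f -> germ a (fun x => expR (f x)).
Proof.
move=> fa.
apply: (@germ_eq _ _ a (fun x => expR (f a) * (expR \o (fun x => f x - f a)) x) _ 1) => //.
  by move=> x _ /=; rewrite -expRD addrC subrK.
apply: germZ; apply: (@germ_comp _ _ a _ (fun k => k`!%:R^-1) 1 (expR 1)) => //.
- exact: abs_bounded_expR.
- by move=> t _; exact: cvg_expR_series.
- by apply: germB => //; exact: germ_cst.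
- by rewrite subrr.
Qed.

(* Mean value theorem: the derivative of the difference is [(- s) ^+ N / (1 + s)]. *)
Lemma ln1_remainder (N : nat) (t : R) : `|t| <= 2^-1 ->
  `|ln (1 + t) - \sum_(k < N) (-1) ^+ k / k.+1%:R * t ^+ k.+1| <= 2^-1 ^+ N.
Proof.
pose h (s : R) := ln (1 + s) - \sum_(k < N) (-1) ^+ k / k.+1%:R * s ^+ k.+1.
pose dh (s : R) := (1 + s)^-1 - \sum_(k < N) (- s) ^+ k.
have hdh (s : R) : 0 < 1 + s -> is_derive s 1 h (dh s).
  move=> s1; apply: is_deriveB.
    rewrite -[X in is_derive _ _ _ X]mulr1.
    apply: (@is_derive1_comp _ (@ln R) (fun u => 1 + u)); first exact: is_derive1_ln.
    by rewrite -[X in is_derive _ _ _ X]add0r; apply: is_deriveD.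
  rewrite [X in is_derive _ _ X _](_ : _ = \sum_(k < N) (fun s => (-1) ^+ k / k.+1%:R * s ^+ k.+1)); last first.
    by apply/funext => u; rewrite fct_sumE.
  apply: is_derive_sum => k.
  rewrite [X in is_derive _ _ X _](_ : _ = horner (((-1) ^+ k / k.+1%:R) *: 'X^(k.+1))).
    apply: is_derive_eq (is_derive_poly _ s) _.
    rewrite derivZ derivXn hornerZ hornerMn hornerXn [RHS]exprNn -(mulr_natl (s ^+ k)) mulrA divfK //.
  by apply/funext => u; rewrite hornerZ hornerXn.
have dh_le (s : R) : `|s| <= 2^-1 -> `|dh s| <= 2 * 2^-1 ^+ N.
  move=> sh; have s1 : 2^-1 <= 1 + s by have := sh; rewrite ler_norml => /andP[]; lra.
  have s0 : 0 < 1 + s by apply: lt_le_trans s1; rewrite invr_gt0.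
  have -> : dh s = (- s) ^+ N / (1 + s).
    rewrite /dh; apply: (mulIf (lt0r_neq0 s0)); rewrite mulrBl mulVf ?lt0r_neq0 //.
    rewrite divfK ?lt0r_neq0 // -[RHS](subrK 1) subrX1; ring.
  rewrite normrM normrX normrN normfV mulrC ler_pM //.
    by rewrite -[leRHS]invrK lef_pV2 ?posrE ?invr_gt0 ?normr_gt0 ?lt0r_neq0 // ger0_norm // ltW.
  by apply: lerXn2r => //; rewrite nnegrE.
have h0 : h 0 = 0.
  rewrite /h addr0 ln1 sub0r big1 ?oppr0 // => k _.
  by rewrite expr0n mulr0.
have mvt (b c : R) : b <= c -> `|b| <= 2^-1 -> `|c| <= 2^-1 ->
    `|h c - h b| <= 2 * 2^-1 ^+ N * (c - b).
  move=> bc b2 c2.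
  have mid (s : R) : b <= s <= c -> `|s| <= 2^-1.
    by move: b2 c2; rewrite !ler_norml => /andP[? ?] /andP[? ?] /andP[? ?]; lra.
  have mid1 (s : R) : b <= s <= c -> 0 < 1 + s.
    by move=> /mid; rewrite ler_norml => /andP[? ?]; lra.
  have [||s sbc ->] := @MVT_segment R h dh b c bc.
  - by move=> s /itvP sbc; apply/hdh/mid1; rewrite !ltW ?sbc.
  - apply: derivable_within_continuous => s; rewrite in_itv /= => /mid1 /hdh hs.
    exact: ex_derive.
  by rewrite normrM (@ger0_norm _ (c - b)) ?subr_ge0 // ler_wpM2r ?subr_ge0 // dh_le // mid // -in_itv.
move=> th; rewrite -/(h t).
have p0 : 0 <= (2^-1 : R) ^+ N by rewrite exprn_ge0.
(* The segment from 0 to [t] has length at most [1/2], which absorbs the factor 2 of [dh_le]. *)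
have [t0|t0] := leP 0 t.
  have := mvt 0 t t0; rewrite normr0 h0 !subr0 invr_ge0 => /(_ (ler0n R 2) th) H.
  apply: le_trans H _; rewrite mulrAC ler_piMl //.
  by move: th; rewrite ger0_norm //; lra.
have := mvt t 0 (ltW t0) th; rewrite normr0 h0 sub0r normrN sub0r invr_ge0 => /(_ (ler0n R 2)) H.
apply: le_trans H _; rewrite mulrAC ler_piMl //.
by move: th; rewrite ltr0_norm //; lra.
Qed.

Lemma germ_ln a f : germ a f -> 0 < f a -> germ a (fun x => ln (f x)).
Proof.
move=> fa fa0; have fn0 := lt0r_neq0 fa0.
apply: (@germ_eq _ _ a ((fun t => ln (f a * (1 + t))) \o (fun x => f x * (f a)^-1 - 1)) _ 1) => //.
  by move=> x _ /=; rewrite addrC subrK mulrCA mulfV // mulr1.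
(* The constant [ln (f a)] sits at index 0, so the series of [ln (1 + t)] starts at index 1. All
   coefficients are at most [|ln (f a)| + 1] in modulus, and the powers of [1/2] sum to 2. *)
pose phi k := if k is k'.+1 then (-1) ^+ k' / k'.+1%:R else ln (f a).
apply: (@germ_comp _ _ a _ phi 2^-1 ((`|ln (f a)| + 1) * 2)) => //.
- have k0 : 0 <= `|ln (f a)| + 1 by rewrite addr_ge0.
  rewrite -(ger0_norm k0); apply: abs_boundedW (abs_boundedZ (`|ln (f a)| + 1) abs_bounded_half) => k.
  rewrite !normrM ler_wpM2r // (ger0_norm k0); case: k => [|k] /=.
    by rewrite lerDl.
  rewrite normrM normrX normrN1 expr1n mul1r normfV normr_nat (@le_trans _ _ 1) ?lerDr //.
  by rewrite invf_le1 // ler1n.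
- move=> t th.
  have t1 : 0 < 1 + t by have := th; rewrite ler_norml => /andP[]; lra.
  rewrite -(cvg_shiftS _) lnM ?posrE //.
  apply/cvgrPdist_le => e e0.
  have /cvgrPdist_le /(_ e e0) [N _ hN] : (fun N => (2^-1 : R) ^+ N) @ \oo --> (0 : R).
    by apply: cvg_expr; rewrite ger0_norm // invf_lt1 // ltr1n.
  exists N => // m /= Nm.
  rewrite /series /= big_nat_recl //= expr0 mulr1 opprD addrACA subrr add0r big_mkord.
  apply: le_trans (ln1_remainder m th) _.
  by have := hN m Nm; rewrite /= sub0r normrN ger0_norm // exprn_ge0.
- apply: germB; last exact: germ_cst.
  by apply: germM => //; exact: germ_cst.
- by rewrite mulfV // subrr.
Qed.

Lemma power_series_sum (I : Type) (s : seq I) (f : I -> (J -> R) -> R) a (r C : R) :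
  0 < r -> (forall i, power_series_bound a r C (f i)) ->
  power_series_bound a r ((size s)%:R * C) (fun x => \sum_(i <- s) f i x).
Proof.
move=> r0 h; elim: s => [|i s IH].
  rewrite mul0r; under eq_fun do rewrite big_nil.
  by have := power_series_cst a 0 r0; rewrite normr0.
under eq_fun do rewrite big_cons.
by rewrite /= -add1n natrD mulrDl mul1r; exact: power_seriesD.
Qed.

(** With a common radius and a common norm bound [C] for the entries of [Y], the entries of [Y ^ k]
    have norm at most [(n C) ^ k], so the exponential series converges in norm with total at most
    [expR (n C)]. *)
Lemma germ_expmx n (Y : (J -> R) -> 'M[R]_n) a :
  (forall i j, germ a (fun x => Y x i j)) ->
  forall i j, germ a (fun x => expmx (Y x) i j).
Proof.
move=> Ya i j.
have [|r [C [r0 hC]]] := @germ_common _ _ _ (enum {: 'I_n * 'I_n}) (fun p x => Y x p.1 p.2) a.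
  by move=> p _; exact: Ya.
have {}hC i' j' : power_series_bound a r C (fun x => Y x i' j').
  by apply: (hC (i', j')); rewrite mem_enum.
have C0 : 0 <= C by case: (hC i j) => c /abs_bounded_ge0.
have D0 : 0 <= n%:R * C by rewrite mulr_ge0.
have pw k : forall i' j', power_series_bound a r ((n%:R * C) ^+ k) (fun x => (Y x ^+ k) i' j').
  elim: k => [|k IH] i' j'.
    apply: (@power_series_eq _ _ a r 1 (fun=> (i' == j')%:R)) => [x _|].
      by rewrite expr0 mxE.
    apply: (power_series_shrink (ltW r0) (lexx r) _ (power_series_cst a (i' == j')%:R r0)).
    by case: eqP; rewrite ?normr1 ?normr0.
  have := @power_series_sum _ (enum 'I_n) (fun l x => (Y x ^+ k) i' l * Y x l j') a r ((n%:R * C) ^+ k * C) r0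
    (fun l => power_seriesM r0 (IH i' l) (hC l j')).
  rewrite size_enum_ord exprSr mulrCA.
  by apply: power_series_eq => x _; rewrite exprSr mxE big_enum.
exists r, (expR (n%:R * C)); split=> //.
apply: (power_series_series (f := fun k x => k`!%:R^-1 * (Y x ^+ k) i j)
  (C := fun k => k`!%:R^-1 * (n%:R * C) ^+ k)) => //.
- move=> k; apply: power_seriesM => //.
  by have := power_series_cst a (k`!%:R^-1) r0; rewrite ger0_norm.
- exact: abs_bounded_expR.
- by move=> x _; exact: cvg_expmx_entry.
Qed.

End germ_functions.

(** * Logarithms of upper triangular matrices *)

Section triangular.
Variables (R : realType) (n : nat).
Implicit Types (A B X Y : 'M[R]_n) (i j : 'I_n).

Lemma agree_eq X Y : agree n X Y -> X = Y.
Proof. by move=> XY; apply/matrixP => i j; apply: XY; exact: ltn_addl. Qed.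

Lemma agree0 X Y : ut X -> ut Y -> agree 0 X Y.
Proof. by move=> /utP hX /utP hY i j; rewrite addn0 => ij; rewrite hX ?hY. Qed.

Lemma agreeS d X Y : agree d X Y ->
  (forall i j, j = (i + d)%N :> nat -> X i j = Y i j) -> agree d.+1 X Y.
Proof.
by move=> XY h i j; rewrite addnS ltnS leq_eqVlt => /orP[/eqP/h //|/XY].
Qed.

Lemma agree_trans d X Y Z : agree d X Y -> agree d Y Z -> agree d X Z.
Proof. by move=> XY YZ i j ij; rewrite XY ?YZ. Qed.

(** The linear equation of one induction step: the change on the [d]-th superdiagonal is linear in
    the increments, with coefficients that depend on diagonal entries only. *)
Lemma mulmx_expmx_top d X X' Y Y' i j : (0 < d)%N ->
  ut X -> ut X' -> ut Y -> ut Y' -> agree d X' X -> agree d Y' Y ->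
  j = (i + d)%N :> nat ->
  (X' *m expmx Y') i j = (X *m expmx Y) i j +
    ((X' i j - X i j) * expR (Y j j) +
     X i i * expR_quot (Y i i) (Y j j) * (Y' i j - Y i j)).
Proof.
move=> d0 uX uX' uY uY' XX YY ij.
rewrite (mulmx_top d0 uX' uX (ut_expmx uY') (ut_expmx uY) XX _ ij); last exact: expmx_agree.
rewrite expmx_diag // (expmx_top d0 uY' uY YY ij) (XX i i) ?(YY i i) ?(YY j j); try lia.
ring.
Qed.

(** The correction added in one induction step. *)
Definition superdiag d (c : 'I_n -> 'I_n -> R) : 'M[R]_n :=
  \matrix_(i, j) if j == (i + d)%N :> nat then c i j else 0.

Lemma agree_superdiag d X c : agree d (X + superdiag d c) X.
Proof. by move=> i j ij; rewrite !mxE; case: eqP => [h|]; [lia|rewrite addr0]. Qed.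

Lemma superdiagE d X c i j : j = (i + d)%N :> nat ->
  (X + superdiag d c) i j = X i j + c i j.
Proof. by move=> ij; rewrite !mxE ij eqxx. Qed.

Lemma ut_superdiag d X c : ut X -> ut (X + superdiag d c).
Proof.
move=> /utP uX; apply/utP => i j ij; rewrite !mxE uX // add0r.
by case: eqP => // h; lia.
Qed.

Lemma ut_diag_mx (v : 'rV[R]_n) : ut (diag_mx v).
Proof. by apply/utP => i j ij; rewrite mxE; case: eqP => // h; move: ij; rewrite h ltnn. Qed.

Lemma UT_ut X : UT X -> ut X. Proof. by case. Qed.

Lemma UT_unitmx X : UT X -> X \in unitmx.
Proof.
move=> [uX X0]; rewrite unitmxE unitfE -det_tr det_trig //.
by apply/prodf_neq0 => i _; rewrite mxE lt0r_neq0.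
Qed.

(** One superdiagonal after the other: the diagonal by injectivity of the real exponential, the
    others by the positive slope in [expmx_top]. *)
Lemma expmx_inj X Y : ut X -> ut Y -> expmx X = expmx Y -> X = Y.
Proof.
move=> uX uY XY; apply: agree_eq.
suff h d : agree d X Y by exact: h.
elim: d => [|d IH]; first exact: agree0.
apply: agreeS => // i j ij; case: d IH ij => [|d] IH ij.
  have -> : j = i by apply: val_inj => /=; lia.
  by apply: expR_inj; rewrite -!expmx_diag // XY.
have := expmx_top (ltn0Sn d) uX uY IH ij.
rewrite XY => /eqP; rewrite -subr_eq0 opprD addrA subrr add0r oppr_eq0 mulf_eq0.
by rewrite gt_eqF ?expR_quot_gt0 //= subr_eq0 => /eqP.
Qed.

(** [Y] is built one superdiagonal at a time, with [X] fixed, by solving a scalar linear equation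
    for each entry. *)
Lemma ut_log_exists X A : UT X -> UT A -> exists2 Y, ut Y & X *m expmx Y = A.
Proof.
move=> UX UA; have uX := UT_ut UX; have uA := UT_ut UA.
(* With [d.+1] the base case is the diagonal, which is solved by real logarithms and not by a linear
   equation. *)
suff h d : exists2 Y, ut Y & agree d.+1 (X *m expmx Y) A.
  have [Y uY XY] := h n; exists Y => //; apply: agree_eq => i j ij.
  by apply: XY; rewrite addnS ltnS ltnW.
elim: d => [|d [Y uY XY]].
  have [Y uY YE] : exists2 Y : 'M[R]_n, ut Y & forall i, Y i i = ln (A i i) - ln (X i i).
    exists (diag_mx (\row_i (ln (A i i) - ln (X i i)))); first exact: ut_diag_mx.
    by move=> i; rewrite !mxE eqxx mulr1n.
  exists Y => //; apply: agreeS => [|i j ij].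
    by apply: agree0 => //; apply: ut_mulmx => //; exact: ut_expmx.
  have -> : j = i by apply: val_inj => /=; lia.
  rewrite (mulmx_diag _ uX (ut_expmx uY)) (expmx_diag _ uY) YE.
  rewrite expRB !lnK ?posrE ?UX.2 ?UA.2 //.
  by rewrite mulrC divfK // lt0r_neq0 // UX.2.
(* The defect divided by the positive slope given by [mulmx_expmx_top]. *)
pose c i j := (A i j - (X *m expmx Y) i j) / (X i i * expR_quot (Y i i) (Y j j)).
have uY' := ut_superdiag d.+1 c uY; have aY' := agree_superdiag (d := d.+1) Y c.
exists (Y + superdiag d.+1 c) => //; apply: agreeS => [|i j ij].
  apply: agree_trans XY; apply: mulmx_agree => //; try exact: ut_expmx.
  exact: expmx_agree.
rewrite (mulmx_expmx_top _ uX uX uY uY' _ aY' ij) // superdiagE // addrAC !subrr mul0r !add0r.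
rewrite /c mulrC divfK; first by rewrite addrC subrK.
by rewrite lt0r_neq0 // mulr_gt0 ?expR_quot_gt0 // UX.2.
Qed.

Lemma logmxK Y : ut Y -> logmx (expmx Y) = Y.
Proof.
move=> uY; apply: pinvKV; last by rewrite in_setE.
by move=> A B; rewrite !in_setE; exact: expmx_inj.
Qed.

(** [logmx] is a chosen preimage, meaningful on the image of [ut] under [expmx]; [ut_log_exists]
    places [X^-1 A] in that image. *)
Lemma logmx_mul X A : UT X -> UT A ->
  ut (logmx (invmx X *m A)) /\ X *m expmx (logmx (invmx X *m A)) = A.
Proof.
move=> UX UA; have [Y uY <-] := ut_log_exists UX UA.
by rewrite (mulKmx (UT_unitmx UX)) logmxK.
Qed.

End triangular.

(** * The linear system on one superdiagonal *)

Section weighted_system.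
Variables (R : realType) (m : nat) (w : 'I_m -> R).
Hypothesis w0 : forall k, 0 < w k.
Hypothesis w1 : \sum_k w k = 1.

(** A total weight of 1 rules out the empty sum. *)
Lemma weighted_sum_gt0 (a : 'I_m -> R) : (forall k, 0 < a k) -> 0 < \sum_k w k * a k.
Proof.
move=> a0; have [k _] : exists k : 'I_m, true.
  apply: contrapT => nk; have := w1; rewrite big1 => [/esym /eqP|k _]; first by rewrite oner_eq0.
  by case: nk; exists k.
rewrite (bigD1 k) //= ltr_wpDr ?mulr_gt0 // sumr_ge0 // => l _.
by rewrite mulr_ge0 // ltW.
Qed.

(** Each equation gives [eta k] in terms of [xi]; the weighted sum then becomes one scalar equation
    for [xi], whose slope is nonzero by positivity. *)
Lemma weighted_systemP (e p b eta : 'I_m -> R) (xi : R) :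
  (forall k, 0 < e k) -> (forall k, 0 < p k) ->
  (forall k, xi * e k + p k * eta k = b k) /\ \sum_k w k * eta k = 0 <->
  xi = (\sum_k w k * (b k / p k)) / (\sum_k w k * (e k / p k)) /\
  forall k, eta k = (b k - xi * e k) / p k.
Proof.
move=> e0 p0; have pn0 k : p k != 0 by exact: lt0r_neq0.
have D0 : \sum_k w k * (e k / p k) != 0.
  by apply/lt0r_neq0/weighted_sum_gt0 => k; exact: divr_gt0.
have E : (forall k, eta k = (b k - xi * e k) / p k) ->
    \sum_k w k * eta k = \sum_k w k * (b k / p k) - xi * \sum_k w k * (e k / p k).
  move=> h; rewrite mulr_sumr -sumrB; apply: eq_bigr => k _; rewrite h; ring.
split=> -[h1 h2].
  have h k : eta k = (b k - xi * e k) / p k by rewrite -h1 addrAC subrr add0r mulrC mulKf.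
  split=> //; apply: (mulIf D0); rewrite divfK //.
  by apply/eqP; rewrite eq_sym -subr_eq0 -E // h2.
split=> [k|]; first by rewrite h2 (mulrC (p k)) divfK // addrC subrK.
by rewrite E // h1 divfK // subrr.
Qed.

End weighted_system.

(** * The Karcher equation *)

(** The Karcher equation freed from inverses and logarithms, the logarithms [Y k] being further
    unknowns. *)
Definition karcher_solution (R : realType) (n m : nat) (w : 'I_m -> R)
    (A : 'I_m -> 'M[R]_n) (X : 'M[R]_n) (Y : 'I_m -> 'M[R]_n) : Prop :=
  [/\ UT X, forall k, ut (Y k), forall k, X *m expmx (Y k) = A k &
      \sum_k w k *: Y k = 0].

(** Depends only on the entries strictly below the [d]-th superdiagonal, so it is analytic as soon
    as these are. *)
Definition truncate (R : realType) (n d : nat) (A : 'M[R]_n) : 'M[R]_n :=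
  \matrix_(i, j) if (i <= j < i + d)%N then A i j else 0.

Section karcher.
Variables (R : realType) (n m : nat) (w : 'I_m -> R).
Hypothesis w0 : forall k, 0 < w k.
Hypothesis w1 : \sum_k w k = 1.
Implicit Types (X : 'M[R]_n) (A Y : 'I_m -> 'M[R]_n) (i j : 'I_n).

Lemma karcher_meanP A X : (forall k, UT (A k)) ->
  is_karcher_mean w A X <->
  karcher_solution w A X (fun k => logmx (invmx X *m A k)).
Proof.
move=> UA; split=> [[UX XA]|[UX _ _ XA]] //.
by split=> // k; have [] := logmx_mul UX (UA k).
Qed.

Lemma karcher_solution_mean A X Y : karcher_solution w A X Y -> is_karcher_mean w A X.
Proof.
move=> [UX uY XY sY]; split=> //; rewrite -[RHS]sY; apply: eq_bigr => k _.
by rewrite -XY (mulKmx (UT_unitmx UX)) logmxK.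
Qed.

Lemma weighted_sum_entry Y i j :
  \sum_k w k *: Y k = 0 -> \sum_k w k * Y k i j = 0.
Proof.
move=> /matrixP /(_ i j); rewrite summxE mxE => h.
by rewrite -[RHS]h; apply: eq_bigr => k _; rewrite mxE.
Qed.

(** On the diagonal, [Y k i i = ln (A k i i) - ln (X i i)]; in the weighted sum the left side
    vanishes and [ln (X i i)] has total weight 1. *)
Lemma karcher_solution_diag A X Y i : karcher_solution w A X Y ->
  X i i = expR (\sum_k w k * ln (A k i i)) /\
  forall k, Y k i i = ln (A k i i) - \sum_l w l * ln (A l i i).
Proof.
move=> [UX uY XY sY]; have X0 := UX.2 i.
have YE k : Y k i i = ln (A k i i) - ln (X i i).
  rewrite -XY (mulmx_diag _ (UT_ut UX) (ut_expmx (uY k))) expmx_diag //.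
  by rewrite lnM ?posrE ?expR_gt0 // expRK addrAC subrr add0r.
have lnX : ln (X i i) = \sum_k w k * ln (A k i i).
  apply/eqP; rewrite eq_sym -subr_eq0 -[ln (X i i)]mul1r -w1 mulr_suml -sumrB.
  apply/eqP; rewrite -[RHS](weighted_sum_entry i i sY).
  by apply: eq_bigr => k _; rewrite YE mulrBr.
by rewrite -lnX lnK ?posrE.
Qed.

(** The pair [(X, Y)] is any approximation correct below the [d]-th superdiagonal: another solution
    in the proof of uniqueness, a truncation in that of analyticity. *)
Lemma karcher_solution_superdiag d A X X' Y Y' i j : (0 < d)%N ->
  karcher_solution w A X' Y' -> ut X -> 0 < X i i -> (forall k, ut (Y k)) ->
  agree d X' X -> (forall k, agree d (Y' k) (Y k)) -> j = (i + d)%N :> nat ->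
  let e k := expR (Y k j j) in
  let p k := X i i * expR_quot (Y k i i) (Y k j j) in
  let b k := A k i j - (X *m expmx (Y k)) i j in
  \sum_k w k * Y k i j = 0 ->
  X' i j - X i j = (\sum_k w k * (b k / p k)) / (\sum_k w k * (e k / p k)) /\
  forall k, Y' k i j - Y k i j = (b k - (X' i j - X i j) * e k) / p k.
Proof.
move=> d0 [UX' uY' XY' sY'] uX X0 uY aX aY ij e p b sY.
apply/(weighted_systemP w0 w1) => [k|k|]; first exact: expR_gt0.
  by rewrite mulr_gt0 // expR_quot_gt0.
split=> [k|].
  rewrite /b -XY' (mulmx_expmx_top d0 uX (UT_ut UX') (uY k) (uY' k) aX (aY k) ij).
  by rewrite addrAC subrr add0r.
under eq_bigr do rewrite mulrBr.
by rewrite sumrB sY subr0 weighted_sum_entry.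
Qed.

Lemma karcher_solution_unique A X X' Y Y' :
  karcher_solution w A X Y -> karcher_solution w A X' Y' -> X' = X.
Proof.
move=> S S'; have [UX uY XY sY] := S; have [UX' uY' XY' sY'] := S'.
apply: agree_eq; suff h d : agree d X' X /\ forall k, agree d (Y' k) (Y k) by case: (h n).
elim: d => [|d [aX aY]].
  by split=> [|k]; apply: agree0 => //; exact: UT_ut.
have diag i j : j = (i + 0)%N :> nat -> j = i by move=> ij; apply: val_inj => /=; lia.
have E i j : j = (i + d)%N :> nat -> X' i j = X i j /\ forall k, Y' k i j = Y k i j.
  case: d aX aY => [|d] aX aY ij.
    rewrite (diag _ _ ij); have [-> YE] := karcher_solution_diag i S.
    by have [-> YE'] := karcher_solution_diag i S'; split=> // k; rewrite YE YE'.
  have [] := karcher_solution_superdiag (ltn0Sn d) S' (UT_ut UX) (UX.2 i) uY aX aY ij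
    (weighted_sum_entry i j sY).
  (* [(X, Y)] is itself a solution, so its defects vanish and both corrections are zero. *)
  rewrite big1 => [|k _]; last by rewrite XY subrr mul0r mulr0.
  rewrite mul0r => XE YE; split=> [|k]; first exact: subr0_eq.
  by apply: subr0_eq; rewrite YE XE XY subrr mul0r subrr mul0r.
split=> [|k]; apply: agreeS => // i j /E [XE YE] //.
Qed.

(** Invariant: the products match [A k] up to the [d]-th superdiagonal, while the weighted sum of
    the [Y k] vanishes exactly at every stage. *)
Lemma karcher_solution_exists A : (forall k, UT (A k)) ->
  exists X Y, karcher_solution w A X Y.
Proof.
move=> UA.
suff h d : exists X Y, [/\ UT X, forall k, ut (Y k),
    forall k, agree d.+1 (X *m expmx (Y k)) (A k) & \sum_k w k *: Y k = 0].
  have [X [Y [UX uY XY sY]]] := h n; exists X, Y; split=> // k.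
  by apply: agree_eq => i j ij; apply: XY; rewrite addnS ltnS ltnW.
have ut_prod (X Y : 'M[R]_n) : UT X -> ut Y -> ut (X *m expmx Y).
  by move=> [uX _] uY; apply: ut_mulmx => //; exact: ut_expmx.
elim: d => [|d [X [Y [UX uY XY sY]]]].
  (* The logarithm of the weighted geometric mean of the diagonal entries. *)
  pose L i := \sum_k w k * ln (A k i i).
  have [X UX XE] : exists2 X, UT X & forall i, X i i = expR (L i).
    exists (diag_mx (\row_i expR (L i))).
      by split=> [|i]; [exact: ut_diag_mx|rewrite !mxE eqxx mulr1n expR_gt0].
    by move=> i; rewrite !mxE eqxx mulr1n.
  have [Y [uY YE sY]] : exists Y, [/\ forall k, ut (Y k),
      forall k i, Y k i i = ln (A k i i) - L i & \sum_k w k *: Y k = 0].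
    exists (fun k => diag_mx (\row_i (ln (A k i i) - L i))); split.
    - by move=> k; exact: ut_diag_mx.
    - by move=> k i; rewrite !mxE eqxx mulr1n.
    - apply/matrixP => i j; rewrite summxE mxE.
      under eq_bigr do rewrite !mxE mulrnAr.
      rewrite sumrMnl; under eq_bigr do rewrite mulrBr.
      by rewrite sumrB -mulr_suml w1 mul1r subrr mul0rn.
  exists X, Y; split=> // k; apply: agreeS => [|i j ij].
    by apply: agree0; [exact: ut_prod|exact: UT_ut].
  have -> : j = i by apply: val_inj => /=; lia.
  rewrite (mulmx_diag _ (UT_ut UX) (ut_expmx (uY k))) expmx_diag // XE YE.
  by rewrite -expRD addrC subrK lnK // posrE (UA k).2.
(* [b] is the defect on the next superdiagonal; [xi] and [eta] are the solution formulas of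
   [weighted_systemP]. *)
pose e k j := expR (Y k j j).
pose p k i j := X i i * expR_quot (Y k i i) (Y k j j).
pose b k i j := A k i j - (X *m expmx (Y k)) i j.
pose xi i j := (\sum_k w k * (b k i j / p k i j)) / (\sum_k w k * (e k j / p k i j)).
pose eta k i j := (b k i j - xi i j * e k j) / p k i j.
have sys i j : (forall k, xi i j * e k j + p k i j * eta k i j = b k i j) /\
    \sum_k w k * eta k i j = 0.
  apply/(weighted_systemP w0 w1) => // k; first exact: expR_gt0.
  by rewrite mulr_gt0 ?expR_quot_gt0 // UX.2.
have aX := agree_superdiag (d := d.+1) X xi.
have aY k := agree_superdiag (d := d.+1) (Y k) (eta k).
have uX' := ut_superdiag d.+1 xi (UT_ut UX).
have uY' k := ut_superdiag d.+1 (eta k) (uY k).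
exists (X + superdiag d.+1 xi), (fun k => Y k + superdiag d.+1 (eta k)); split=> //.
- by split=> // i; rewrite aX ?addnS ?ltnS ?leq_addr // UX.2.
- move=> k; apply: agreeS => [|i j ij].
    apply: agree_trans (XY k).
    exact: mulmx_agree uX' (UT_ut UX) (ut_expmx (uY' k)) (ut_expmx (uY k)) aX
      (expmx_agree (uY' k) (uY k) (aY k)).
  rewrite (mulmx_expmx_top _ (UT_ut UX) uX' (uY k) (uY' k) aX (aY k) ij) // !superdiagE //.
  rewrite ![_ + _ - _]addrAC !subrr !add0r.
  by have [h _] := sys i j; rewrite h addrC subrK.
- under eq_bigr do rewrite scalerDr.
  rewrite big_split /= sY add0r; apply/matrixP => i j; rewrite summxE mxE.
  under eq_bigr do rewrite !mxE.
  case: eqP => _; last by rewrite big1 // => k _; rewrite mulr0.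
  by have [_ h] := sys i j; rewrite -[RHS]h.
Qed.

End karcher.

(** * Analytic dependence of the solution *)

Section karcher_germ.
Variables (R : realType) (n m : nat) (w : 'I_m -> R).
Hypothesis w0 : forall k, 0 < w k.
Hypothesis w1 : \sum_k w k = 1.

Lemma ut_truncate d (A : 'M[R]_n) : ut (truncate d A).
Proof. by apply/utP => i j ij; rewrite mxE leqNgt ij. Qed.

Lemma agree_truncate d (A : 'M[R]_n) : ut A -> agree d A (truncate d A).
Proof. by move=> /utP uA i j ij; rewrite mxE ij andbT; case: leqP => // /uA. Qed.

Lemma truncate_diag d (A : 'M[R]_n) i : truncate d.+1 A i i = A i i.
Proof. by rewrite mxE leqnn addnS ltnS leq_addr. Qed.

Lemma truncate_superdiag d (A : 'M[R]_n) (i j : 'I_n) :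
  j = (i + d)%N :> nat -> truncate d A i j = 0.
Proof. by move=> ij; rewrite mxE ij ltnn andbF. Qed.

Variables (J : finType) (a : J -> R).

Lemma germ_truncate d (Y : (J -> R) -> 'M[R]_n) :
  (forall i j : 'I_n, (j < i + d)%N -> germ a (fun x => Y x i j)) ->
  forall i j, germ a (fun x => truncate d (Y x) i j).
Proof.
move=> Ya i j; under eq_fun do rewrite mxE.
case: (boolP (i <= j < i + d)%N) => [/andP[_ ij]|_]; first exact: Ya.
exact: germ_cst.
Qed.

(* The divided difference is itself an entry of a difference of two matrix
   exponentials. *)
Lemma germ_expR_quot d (T : (J -> R) -> 'M[R]_n) (i j : 'I_n) : (0 < d)%N ->
  j = (i + d)%N :> nat -> (forall x, ut (T x)) ->
  (forall k l, germ a (fun x => T x k l)) ->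
  germ a (fun x => expR_quot (T x i i) (T x j j)).
Proof.
move=> d0 ij uT Ta; pose T1 x := T x + superdiag d (fun _ _ => 1).
apply: (@germ_eq _ _ a (fun x => expmx (T1 x) i j - expmx (T x) i j) _ 1) => // [x _|].
  have aT := agree_superdiag (d := d) (T x) (fun _ _ => 1).
  rewrite (expmx_top d0 (ut_superdiag d _ (uT x)) (uT x) aT ij) (superdiagE _ _ ij).
  rewrite (aT i i) ?(aT j j); try lia.
  ring.
apply: germB; apply: germ_expmx => // k l.
under eq_fun do rewrite mxE.
by apply: germD => //; under eq_fun do rewrite mxE; exact: germ_cst.
Qed.

Lemma germ_mulmx (P Q : (J -> R) -> 'M[R]_n) :
  (forall i j, germ a (fun x => P x i j)) -> (forall i j, germ a (fun x => Q x i j)) ->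
  forall i j, germ a (fun x => (P x *m Q x) i j).
Proof.
move=> Pa Qa i j; under eq_fun do rewrite mxE.
by apply: germ_sum => l; exact: germM.
Qed.

(** The formulas of [karcher_solution_diag] and [karcher_solution_superdiag] use only operations
    that preserve germs. The [Y k] go through the induction together with [X] because each step
    needs both. *)
Lemma germ_karcher_solution (A Y : (J -> R) -> 'I_m -> 'M[R]_n)
    (X : (J -> R) -> 'M[R]_n) (s : R) : 0 < s ->
  (forall x, in_box a s x -> karcher_solution w (A x) (X x) (Y x)) ->
  (forall k, UT (A a k)) -> (forall k i j, germ a (fun x => A x k i j)) ->
  forall i j, germ a (fun x => X x i j).
Proof.
move=> s0 sol UA Aa.
have Sa : karcher_solution w (A a) (X a) (Y a).
  by apply: sol => j; rewrite subrr normr0.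
suff h d : (forall i j : 'I_n, (j < i + d)%N -> germ a (fun x => X x i j)) /\
    forall k (i j : 'I_n), (j < i + d)%N -> germ a (fun x => Y x k i j).
  by move=> i j; apply: (h n).1; exact: ltn_addl.
elim: d => [|d [IHX IHY]].
  split=> [i j|k i j]; rewrite addn0 => ij; apply: germ_eq s0 _ (germ_cst a 0) => x /sol [UX uY _ _].
    by have /utP -> := UT_ut UX.
  by have /utP -> := uY k.
have step : (forall i j : 'I_n, j = (i + d)%N :> nat -> germ a (fun x => X x i j) /\
    forall k, germ a (fun x => Y x k i j)).
  move=> i j ij; case: d IHX IHY ij => [|d] IHX IHY ij.
    have -> : j = i by apply: val_inj => /=; lia.
    have gl k : germ a (fun x => ln (A x k i i)) by apply: germ_ln => //; exact: (UA k).2.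
    have gL : germ a (fun x => \sum_k w k * ln (A x k i i)).
      by apply: germ_sum => k; exact: germZ.
    split=> [|k].
      apply: germ_eq s0 _ (germ_expR gL) => x /sol S.
      by have [] := karcher_solution_diag w1 i S.
    apply: germ_eq s0 _ (germB (gl k) gL) => x /sol S.
    by have [_] := karcher_solution_diag w1 i S.
  (* Only part of the entries is known to be analytic so far; truncation gives matrices with all
     entries analytic, to which [germ_expmx] applies. *)
  pose T x k := truncate d.+1 (Y x k); pose S x := truncate d.+1 (X x).
  have gT k : forall i j, germ a (fun x => T x k i j) by apply: germ_truncate; exact: IHY.
  have gS : forall i j, germ a (fun x => S x i j) by exact: germ_truncate.
  pose e x k := expR (T x k j j).
  pose p x k := S x i i * expR_quot (T x k i i) (T x k j j).
  pose b x k := A x k i j - (S x *m expmx (T x k)) i j.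
  have ge k : germ a (fun x => e x k) by exact: germ_expR.
  have gp k : germ a (fun x => p x k).
    apply: germM => //; apply: (@germ_expR_quot d.+1) => // x; exact: ut_truncate.
  have gb k : germ a (fun x => b x k).
    apply: germB => //; apply: germ_mulmx => //; exact: germ_expmx.
  (* Nonvanishing at the centre [a] is what [germV] asks of a denominator. *)
  have p0 k : 0 < p a k.
    rewrite /p mulr_gt0 ?expR_quot_gt0 // /S truncate_diag.
    by have [UX _ _ _] := Sa; exact: UX.2.
  have gpV k : germ a (fun x => (p x k)^-1) by apply: germV => //; exact: lt0r_neq0.
  pose xi x := (\sum_k w k * (b x k / p x k)) / (\sum_k w k * (e x k / p x k)).
  have gxi : germ a xi.
    apply: germM.
      by apply: germ_sum => k; apply: germZ; exact: germM.
    apply: germV.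
      by apply: germ_sum => k; apply: germZ; exact: germM.
    apply: lt0r_neq0; apply: (weighted_sum_gt0 w0 w1) => k.
    by rewrite divr_gt0 // expR_gt0.
  have E x : in_box a s x -> X x i j = xi x /\
      forall k, Y x k i j = (b x k - xi x * e x k) / p x k.
    move=> /sol Sx; have [UX uY _ _] := Sx.
    have Sii : S x i i = X x i i by exact: truncate_diag.
    (* The truncations vanish at [(i, j)], so the increments of [karcher_solution_superdiag] are the
       entries themselves and its condition on the weighted sum holds. *)
    have Sij : S x i j = 0 by exact: truncate_superdiag.
    have Tij k : T x k i j = 0 by exact: truncate_superdiag.
    have S0 : 0 < S x i i by rewrite Sii UX.2.
    have [] := karcher_solution_superdiag w0 w1 (ltn0Sn d) Sx (ut_truncate _ _) S0
      (fun k => ut_truncate _ _) (agree_truncate (UT_ut UX))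
      (fun k => agree_truncate (uY k)) ij.
      by rewrite big1 // => k _; rewrite -/(T x k) Tij mulr0.
    rewrite -/(S x) => XE YE; split=> [|k]; first by rewrite -[LHS]subr0 -Sij XE.
    by rewrite -[LHS]subr0 -(Tij k) YE XE.
  split=> [|k]; first by apply: germ_eq s0 _ gxi => x /E [->].
  apply: germ_eq s0 _ (germM (germB (gb k) (germM gxi (ge k))) (gpV k)) => x /E [_ ->].
  by [].
split=> [i j|k i j]; rewrite addnS ltnS leq_eqVlt => /orP[/eqP ij|].
- exact: (step i j ij).1.
- exact: IHX.
- exact: (step i j ij).2.
- exact: IHY.
Qed.

End karcher_germ.

(** * Coordinates on tuples of triangular matrices, and the conclusion *)

Lemma ut_utmx (R : realType) n (v : upper n -> R) : ut (utmx v).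
Proof.
apply/utP => i j ij; rewrite mxE; case: insubP => // u /= h.
by rewrite leqNgt ij in h.
Qed.

Lemma germ_ut_tuple (R : realType) n m (a : 'I_m * upper n -> R) k (i j : 'I_n) :
  germ a (fun x => ut_tuple x k i j).
Proof.
under eq_fun do rewrite mxE.
by case: insub => [p|] /=; [exact: germ_coord|exact: germ_cst].
Qed.

(** Openness of [UT]: a diagonal entry moved by less than the smallest one stays positive. The
    initial value 1 of the minimum keeps [s] positive even for an empty family. *)
Lemma UT_tuple_box (R : realType) n m (a : 'I_m * upper n -> R) :
  (forall k, UT (ut_tuple a k)) -> exists2 s : R, 0 < s &
    forall x, in_box a s x -> forall k, UT (ut_tuple x k).
Proof.
move=> Ua; pose s := \big[Num.min/1]_(p : 'I_m * 'I_n) ut_tuple a p.1 p.2 p.2.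
exists s; first by rewrite lt_bigmin // => p _; exact: (Ua p.1).2.
move=> x xs k; split=> [|i]; first exact: ut_utmx.
have : s <= ut_tuple a k i i.
  exact: (bigmin_le_cond (j := (k, i)) _ (fun p => ut_tuple a p.1 p.2 p.2)).
rewrite !mxE; case: insubP => [p _ _ /= h|]; last by rewrite /= leqnn.
by have := lt_le_trans (xs (k, p)) h; rewrite ltr_norml => /andP[]; lra.
Qed.

Theorem theorem5p1 (R : realType) (n m : nat) (w : 'I_m -> R)
    (w01 : forall i, 0 < w i < 1) (w_sum : \sum_i w i = 1) :
  (forall A : 'I_m -> 'M[R]_n, (forall i, UT (A i)) ->
     exists! X : 'M[R]_n, is_karcher_mean w A X) /\
  (forall K : ('I_m -> 'M[R]_n) -> 'M[R]_n,
     (forall A, (forall i, UT (A i)) -> is_karcher_mean w A (K A)) ->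
     analytic_on_UT K).
Proof.
have w0 k : 0 < w k by case/andP: (w01 k).
split=> [A UA|K KP i j a Ua].
  have [X [Y S]] := karcher_solution_exists w0 w_sum UA.
  exists X; split; first exact: karcher_solution_mean S.
  move=> X' /(karcher_meanP w X' UA) S'.
  exact: (karcher_solution_unique w0 w_sum S' S).
(* [K] is known to yield Karcher means on tuples in [UT]; a small box around [a] stays there, and
   the logarithms serve as the [Y k]. *)
apply: germ_analytic; have [s s0 sU] := UT_tuple_box Ua.
apply: (germ_karcher_solution (A := @ut_tuple R n m)
  (Y := fun x k => logmx (invmx (K (ut_tuple x)) *m ut_tuple x k)) w0 w_sum s0) => //.
  by move=> x /sU UA; apply/karcher_meanP => //; exact: KP.
by move=> k i' j'; exact: germ_ut_tuple.
Qed.
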